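(* Let $k$ be a field. (1) If the $\mathbb N$-filtered Lie algebra $L$ over $k$ is well-covered, then $\mathcal X^*(L)$ for $*\in\{\le,\triangleleft\}$ are stable classes of subalgebras. (2) If the $\mathbb Z$-filtered Lie algebra $L$ over $k$ is well-covered, then $\mathcal X_0^{\le}(L)$ is a stable class of subalgebras.
   Context: **Filtered Lie algebras.** $(A,B)$ denotes the span of brackets. An $\mathbb N$-filtered Lie algebra $L$ has subspaces $L=L_0\supset L_1\supset\cdots$ of finite codimension with $(L_i,L_j)\subset L_{i+j}$, $\bigcap L_i=0$. A $\mathbb Z$-filtered Lie algebra has a decreasing filtration by subspaces $L_j$ ($j\in\mathbb Z$), $(L_i,L_j)\subset L_{i+j}$, all $L_j$ commensurable with $L_0$, $\bigcup L_j=L$, $\bigcap L_j=0$; its positive part is $L_0$, $\mathbb N$-filtered by $(L_j)_{j\ge0}$. For $K/k$ a finite extension, $L\otimes K$ is filtered by $L_j\otimes K$. A subspace $H$ is closed if $H=\bigcap_j(H+L_j\otimes K)$. $H$ is commensurable with $L_0\otimes K$ if $H\cap(L_0\otimes K)$ has finite codimension in $H$ and in $L_0\otimes K$; its codimension in $L_0\otimes K$ is then the sum of these two codimensions. **Well-covered.** An $\mathbb N$-filtered Lie algebra $L$ is well-covered if for each $n$ there exists some $f(n)$ such that $L_{f(n)}=(L_i,L_{f(n)-i})$ for $n+1$ values of $i<f(n)/2$. A $\mathbb Z$-filtered Lie algebra is well-covered if its positive part is well-covered. **Classes of subalgebras.** A class $\mathcal X$ of subalgebras of $L$ is a family $\mathcal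 X(K)$ of subalgebras of $L\otimes K$ for every finite extension $K$ of $k$. $\mathcal X^{\le}(L)(K)$ is the set of all closed subalgebras of $L\otimes K$, $\mathcal X^{\triangleleft}(L)(K)$ the set of those that are ideals of $L\otimes K$. For $L$ $\mathbb Z$-filtered, $\mathcal X_0^{\le}(L)(K)$ is the set of members of $\mathcal X^{\le}(L)(K)$ commensurable with $L_0\otimes K$. $A_n(\mathcal X)(K)$ is the set of $H\in\mathcal X(K)$ of codimension $n$ (in $L\otimes K$ in the $\mathbb N$-filtered case; in $L_0\otimes K$ in the $\mathbb Z$-filtered commensurable case, where the codimension of $H$ in $L_0\otimes K$ means the sum of the codimension of $H\cap(L_0\otimes K)$ in $H$ and its codimension in $L_0\otimes K$), and $A_{l,n}(\mathcal X)(K)=\{H\in A_n(\mathcal X)(K): H\supseteq L_l\otimes K\}$. Let $X_l$ be the variety $\mathrm{Gr}(L/L_l)$ (resp. $\mathrm{Gr}(L_{-l}/L_l)$ in the $\mathbb Z$-filtered case) of all linear subspaces of the given finite dimensional space. $\mathcal X$ is *constructible* if for all $l,n\in\mathbb N$ the members of $A_{l,n}(\mathcal X)(K)$ ($K$ varying; in the $\mathbb Z$-filtered case, those contained in $L_{-l}\otimes K$) form the set of $K$-points of a constructible subset of $X_l$. $\mathcal X$ is *stable* if it is constructible and for every $n$ there is $l$ such that $A_{l,n}(\mathcal X)(K)=A_{j,n}(\mathcal X)(K)$ for all $j\ge l$ and all $K$. *)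

(* Defs.v *)
From HB Require Import structures.
From mathcomp Require Import all_boot all_order all_algebra all_field.
From mathcomp Require Import mpoly.
From mathcomp Require Import boolp classical_sets.

Set Implicit Arguments.
Unset Strict Implicit.
Unset Printing Implicit Defensive.

Import GRing.Theory.
Local Open Scope classical_set_scope.
Local Open Scope ring_scope.

HB.mixin Record Lmodule_isLie (k : fieldType) L of GRing.Lmodule k L := {
  lie : L -> L -> L;
  lieDl : forall x y z, lie (x + y) z = lie x z + lie y z;
  lieDr : forall x y z, lie x (y + z) = lie x y + lie x z;
  lieZl : forall a x y, lie (a *: x) y = a *: lie x y;
  lieZr : forall a x y, lie x (a *: y) = a *: lie x y;
  liexx : forall x, lie x x = 0;
  lie_jacobi : forall x y z,
    lie x (lie y z) + lie y (lie z x) + lie z (lie x y) = 0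
}.

#[short(type="lieAlgType")]
HB.structure Definition LieAlgebra (k : fieldType) :=
  {L of Lmodule_isLie k L & GRing.Lmodule k L}.

Section LieTheory.
Variables (k : fieldType) (L : lieAlgType k).
Implicit Types x y : L.

Lemma lie0l x : lie 0 x = 0.
Proof. by have := lieZl (0 : k) 0 x; rewrite !scale0r. Qed.

Lemma lie0r x : lie x 0 = 0.
Proof. by have := lieZr (0 : k) x 0; rewrite !scale0r. Qed.

Lemma lieC x y : lie x y = - lie y x.
Proof.
apply/eqP; rewrite -addr_eq0; have := liexx (x + y).
by rewrite lieDl !lieDr !liexx add0r addr0 => ->.
Qed.

Lemma lie_suml (I : Type) (s : seq I) (P : pred I) (F : I -> L) y :
  lie (\sum_(i <- s | P i) F i) y = \sum_(i <- s | P i) lie (F i) y.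
Proof. exact: (big_morph (lie^~ y) (fun u v => lieDl u v y) (lie0l y)). Qed.

Lemma lie_sumr (I : Type) (s : seq I) (P : pred I) (F : I -> L) x :
  lie x (\sum_(i <- s | P i) F i) = \sum_(i <- s | P i) lie x (F i).
Proof. exact: (big_morph (lie x) (lieDr x) (lie0r x)). Qed.

End LieTheory.

Section Subspaces.
Variables (k : fieldType) (M : lmodType k).
Implicit Types A B : set M.

Definition subspace A : Prop :=
  A 0 /\ forall (a : k) x y, A x -> A y -> A (a *: x + y).

Definition lspan A : set M := smallest subspace A.

(** The [v i] lie in [A] and their classes form a basis of [A / B]. *)
Definition basis_mod A B n (v : 'I_n -> M) : Prop :=
  [/\ B `<=` A, forall i, A (v i) &
      forall x, A x -> exists! c : 'rV[k]_n, B (x - \sum_i c 0 i *: v i)].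

(** [B] has codimension [n] in [A]. *)
Definition codim A B n : Prop := exists v : 'I_n -> M, basis_mod A B v.

Definition fincodim A B : Prop := exists n, codim A B n.

Definition commensurable A B : Prop :=
  fincodim A (A `&` B) /\ fincodim B (A `&` B).

Definition codim_sum A B n : Prop :=
  exists a b, [/\ codim B (B `&` A) a, codim A (B `&` A) b & n = (a + b)%N].

End Subspaces.

Section LieSubspaces.
Variables (k : fieldType) (L : lieAlgType k).
Implicit Types A B H : set L.

Definition lie_prod A B : set L := lspan [set lie x y | x in A & y in B].

Definition subalgebra H : Prop :=
  subspace H /\ forall x y, H x -> H y -> H (lie x y).

Definition lie_ideal H : Prop :=
  subspace H /\ forall x y, H y -> H (lie x y).

Lemma ideal_subalgebra H : lie_ideal H -> subalgebra H.
Proof. by case=> sH iH; split=> // x y _; exact: iH. Qed.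

End LieSubspaces.

(** For a finite extension [K] of [k] with [k]-basis [(e_i)], the tensor
    product [L (x) K] is modelled by the families [(t_i)] of elements of [L],
    standing for [\sum_i t_i (x) e_i]; [pure x a] is [x (x) a].  Its universal
    property is given by [tens_liftD], [tens_lift_pure] and [tens_ext];
    [scale_pure] and [lie_pure] characterise its [K]-Lie algebra structure. *)
Definition tens (k : fieldType) (L : lmodType k) (K : fieldExtType k) : Type :=
  {ffun 'I_(\dim {:K}) -> L}.

HB.instance Definition _ (k : fieldType) (L : lmodType k)
  (K : fieldExtType k) := GRing.Zmodule.copy (tens L K)
    {ffun 'I_(\dim {:K}) -> L}.

Section Tensor.
Variables (k : fieldType) (K : fieldExtType k).

Let e (i : 'I_(\dim {:K})) : K := (vbasis {:K})`_i.
Let co (i : 'I_(\dim {:K})) (a : K) : k := coord (vbasis {:K}) i a.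

Let coE a : a = \sum_i co i a *: e i.
Proof. exact: coord_vbasis (memvf a). Qed.

Let coD i a b : co i (a + b) = co i a + co i b.
Proof. by rewrite /co linearD. Qed.

Let coZ i (a : k) b : co i (a *: b) = a * co i b.
Proof. by rewrite /co linearZ. Qed.

Let co_e i j : co i (e j) = (i == j)%:R.
Proof.
by rewrite /co /e coord_free ?(basis_free (vbasisP _)) // eq_sym.
Qed.

Section Module.
Variable L : lmodType k.
Implicit Types (x y : L) (t u : tens L K) (a b : K).

Definition pure x a : tens L K := [ffun i => co i a *: x].

Definition tens_coef t (i : 'I_(\dim {:K})) : L :=
  (t : {ffun 'I_(\dim {:K}) -> L}) i.

Lemma tensP t u : (forall i, tens_coef t i = tens_coef u i) -> t = u.
Proof. by move=> h; apply/ffunP. Qed.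

Lemma tens_coefD t u i : tens_coef (t + u) i = tens_coef t i + tens_coef u i.
Proof. by rewrite /tens_coef ffunE. Qed.

Lemma tens_coef0 i : tens_coef 0 i = 0.
Proof. by rewrite /tens_coef ffunE. Qed.

Lemma tens_coef_sum (I : Type) (s : seq I) (P : pred I) (F : I -> tens L K) i :
  tens_coef (\sum_(j <- s | P j) F j) i =
  \sum_(j <- s | P j) tens_coef (F j) i.
Proof.
exact: (big_morph (tens_coef^~ i) (fun u v => tens_coefD u v i)
  (tens_coef0 i)).
Qed.

Lemma tens_coef_pure x a i : tens_coef (pure x a) i = co i a *: x.
Proof. by rewrite /tens_coef ffunE. Qed.

Lemma pureDl x y a : pure (x + y) a = pure x a + pure y a.
Proof.
by apply: tensP => i; rewrite tens_coefD !tens_coef_pure scalerDr.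
Qed.

Lemma pureDr x a b : pure x (a + b) = pure x a + pure x b.
Proof.
by apply: tensP => i; rewrite tens_coefD !tens_coef_pure coD scalerDl.
Qed.

Lemma pureZ (c : k) x a : pure (c *: x) a = pure x (c *: a).
Proof.
by apply: tensP => i; rewrite !tens_coef_pure coZ scalerA mulrC.
Qed.

Lemma pure0l a : pure 0 a = 0.
Proof. by apply: tensP => i; rewrite tens_coef_pure scaler0 tens_coef0. Qed.

Lemma pure0r x : pure x 0 = 0.
Proof. by have := pureZ 0 x 0; rewrite !scale0r pure0l => <-. Qed.

Lemma pure_suml (I : Type) (s : seq I) (P : pred I) (F : I -> L) a :
  pure (\sum_(j <- s | P j) F j) a = \sum_(j <- s | P j) pure (F j) a.
Proof. exact: (big_morph (pure^~ a) (fun x y => pureDl x y a) (pure0l a)). Qed.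

Lemma pure_sumr (I : Type) (s : seq I) (P : pred I) (F : I -> K) x :
  pure x (\sum_(j <- s | P j) F j) = \sum_(j <- s | P j) pure x (F j).
Proof. exact: (big_morph (pure x) (pureDr x) (pure0r x)). Qed.

Lemma tensE t : t = \sum_i pure (tens_coef t i) (e i).
Proof.
apply: tensP => j; rewrite tens_coef_sum (bigD1 j) //= big1 => [|i nij].
  by rewrite tens_coef_pure co_e eqxx scale1r addr0.
by rewrite tens_coef_pure co_e eq_sym (negPf nij) scale0r.
Qed.

Lemma tens_ind (P : tens L K -> Prop) :
  P 0 -> (forall t u, P t -> P u -> P (t + u)) ->
  (forall x a, P (pure x a)) -> forall t, P t.
Proof. by move=> P0 PD Pp t; rewrite [t]tensE; apply: big_ind. Qed.

Lemma tens_ext (V : nmodType) (f g : tens L K -> V) :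
  {morph f : t u / t + u} -> {morph g : t u / t + u} -> f 0 = 0 -> g 0 = 0 ->
  (forall x a, f (pure x a) = g (pure x a)) -> f =1 g.
Proof.
move=> fD gD f0 g0 fg; apply: tens_ind => [|t u ht hu|//].
  by rewrite f0 g0.
by rewrite fD gD ht hu.
Qed.

Definition tens_lift (V : nmodType) (f : L -> K -> V) t : V :=
  \sum_i f (tens_coef t i) (e i).

Lemma tens_liftD (V : nmodType) (f : L -> K -> V) :
  (forall a, {morph f^~ a : x y / x + y}) ->
  {morph tens_lift f : t u / t + u}.
Proof.
move=> fD t u; rewrite /tens_lift -big_split /=; apply: eq_bigr => i _.
by rewrite tens_coefD fD.
Qed.

Lemma tens_lift_pure (V : nmodType) (f : L -> K -> V) x a :
  (forall x, {morph f x : a b / a + b}) -> (forall x, f x 0 = 0) ->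
  (forall (c : k) x a, f (c *: x) a = f x (c *: a)) ->
  tens_lift f (pure x a) = f x a.
Proof.
move=> fD f0 fZ; rewrite [in RHS](coE a) (big_morph (f x) (fD x) (f0 x)).
by apply: eq_bigr => i _; rewrite tens_coef_pure fZ.
Qed.

Let tens_scale a t : tens L K := tens_lift (fun x b => pure x (a * b)) t.

Let tens_scaleD a : {morph tens_scale a : t u / t + u}.
Proof. by apply: tens_liftD => b x y; rewrite pureDl. Qed.

Let tens_scale0 a : tens_scale a 0 = 0.
Proof.
by rewrite /tens_scale /tens_lift big1 // => i _; rewrite tens_coef0 pure0l.
Qed.

Let tens_scale_pure a x b : tens_scale a (pure x b) = pure x (a * b).
Proof.
rewrite /tens_scale tens_lift_pure //.
- by move=> y c d; rewrite mulrDr pureDr.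
- by move=> y; rewrite mulr0 pure0r.
- by move=> c y d; rewrite pureZ scalerAr.
Qed.

Fact tens_scaleA a b t : tens_scale a (tens_scale b t) = tens_scale (a * b) t.
Proof.
elim/tens_ind: t => [|t u ht hu|x c]; first by rewrite !tens_scale0.
  by rewrite !tens_scaleD ht hu.
by rewrite !tens_scale_pure mulrA.
Qed.

Fact tens_scale1 : left_id 1 tens_scale.
Proof.
move=> t; elim/tens_ind: t => [|t u ht hu|x c]; first by rewrite !tens_scale0.
  by rewrite !tens_scaleD ht hu.
by rewrite !tens_scale_pure mul1r.
Qed.

Fact tens_scaleDr : right_distributive tens_scale +%R.
Proof. by move=> a t u; rewrite tens_scaleD. Qed.

Fact tens_scaleDl t : {morph tens_scale^~ t : a b / a + b}.
Proof.
move=> a b; elim/tens_ind: t => [|t u ht hu|x c].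
- by rewrite !tens_scale0 addr0.
- by rewrite !tens_scaleD ht hu addrACA.
- by rewrite !tens_scale_pure mulrDl pureDr.
Qed.

HB.instance Definition _ := GRing.Zmodule_isLmodule.Build K (tens L K)
  tens_scaleA tens_scale1 tens_scaleDr tens_scaleDl.

Lemma scale_pure a x b : a *: pure x b = pure x (a * b).
Proof. exact: tens_scale_pure. Qed.

End Module.

Section Lie.
Variable L : lieAlgType k.
Implicit Types (x y : L) (t u w : tens L K) (a b : K).

Let tlie t u : tens L K :=
  tens_lift (fun x a => tens_lift (fun y b => pure (lie x y) (a * b)) u) t.

Let tlieE t u : tlie t u =
  \sum_i \sum_j pure (lie (tens_coef t i) (tens_coef u j)) (e i * e j).
Proof. by []. Qed.

Fact tens_lieDl t u w : tlie (t + u) w = tlie t w + tlie u w.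
Proof.
rewrite !tlieE -big_split /=; apply: eq_bigr => i _.
rewrite -big_split /=; apply: eq_bigr => j _.
by rewrite tens_coefD lieDl pureDl.
Qed.

Fact tens_lieDr t u w : tlie t (u + w) = tlie t u + tlie t w.
Proof.
rewrite !tlieE -big_split /=; apply: eq_bigr => i _.
rewrite -big_split /=; apply: eq_bigr => j _.
by rewrite tens_coefD lieDr pureDl.
Qed.

Let tlie0l t : tlie 0 t = 0.
Proof. by apply: (addIr (tlie 0 t)); rewrite -tens_lieDl !add0r. Qed.

Let tlie0r t : tlie t 0 = 0.
Proof. by apply: (addIr (tlie t 0)); rewrite -tens_lieDr !add0r. Qed.

Let tlie_pure x a y b : tlie (pure x a) (pure y b) = pure (lie x y) (a * b).
Proof.
have inner z c : tens_lift (fun y b => pure (lie z y) (c * b)) (pure y b)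
    = pure (lie z y) (c * b).
  rewrite tens_lift_pure //.
  - by move=> y' p q; rewrite mulrDr pureDr.
  - by move=> y'; rewrite mulr0 pure0r.
  - by move=> p y' q; rewrite lieZr pureZ scalerAr.
transitivity (tens_lift (fun z c => pure (lie z y) (c * b)) (pure x a)).
  by apply: eq_bigr => i _; rewrite inner.
rewrite tens_lift_pure //.
- by move=> z p q; rewrite mulrDl pureDr.
- by move=> z; rewrite mul0r pure0r.
- by move=> p z q; rewrite lieZl pureZ scalerAl.
Qed.

Fact tens_lieZl a t u : tlie (a *: t) u = a *: tlie t u.
Proof.
elim/tens_ind: t => [|t t' ht ht'|x b].
- by rewrite scaler0 tlie0l scaler0.
- by rewrite scalerDr !tens_lieDl ht ht' scalerDr.
elim/tens_ind: u => [|u u' hu hu'|y c].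
- by rewrite !tlie0r scaler0.
- by rewrite !tens_lieDr hu hu' scalerDr.
- by rewrite scale_pure !tlie_pure scale_pure mulrA.
Qed.

Let tlieC t u : tlie t u + tlie u t = 0.
Proof.
elim/tens_ind: t => [|t t' ht ht'|x b].
- by rewrite tlie0l tlie0r addr0.
- by rewrite tens_lieDl tens_lieDr addrACA ht ht' addr0.
elim/tens_ind: u => [|u u' hu hu'|y c].
- by rewrite tlie0l tlie0r addr0.
- by rewrite tens_lieDl tens_lieDr addrACA hu hu' addr0.
- by rewrite !tlie_pure [c * b]mulrC -pureDl [lie x y]lieC addNr pure0l.
Qed.

Fact tens_lieZr a t u : tlie t (a *: u) = a *: tlie t u.
Proof.
have C v w : tlie v w = - tlie w v by apply/eqP; rewrite -addr_eq0 tlieC.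
by rewrite C tens_lieZl [tlie t u]C scalerN.
Qed.

Fact tens_liexx t : tlie t t = 0.
Proof.
elim/tens_ind: t => [|t u ht hu|x a]; first exact: tlie0l.
  by rewrite tens_lieDl !tens_lieDr ht hu add0r addr0 tlieC.
by rewrite tlie_pure liexx pure0l.
Qed.

Fact tens_jacobi t u w :
  tlie t (tlie u w) + tlie u (tlie w t) + tlie w (tlie t u) = 0.
Proof.
have H (a b c a' b' c' : tens L K) : a + b + c = 0 -> a' + b' + c' = 0 ->
    (a + a') + (b + b') + (c + c') = 0.
  by move=> h h'; rewrite (addrACA a) (addrACA (a + b)) h h' addr0.
elim/tens_ind: t => [|t t' ht ht'|x a].
- by rewrite !(tlie0l, tlie0r) !addr0.
- by rewrite !(tens_lieDl, tens_lieDr) H.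
elim/tens_ind: u => [|u u' hu hu'|y b].
- by rewrite !(tlie0l, tlie0r) !addr0.
- by rewrite !(tens_lieDl, tens_lieDr) H.
elim/tens_ind: w => [|w w' hw hw'|z c].
- by rewrite !(tlie0l, tlie0r) !addr0.
- by rewrite !(tens_lieDl, tens_lieDr) H.
rewrite !tlie_pure.
have -> : b * (c * a) = a * (b * c) by rewrite mulrA mulrC.
have -> : c * (a * b) = a * (b * c) by rewrite mulrCA [c * b]mulrC.
by rewrite -!pureDl lie_jacobi pure0l.
Qed.

HB.instance Definition _ := Lmodule_isLie.Build K (tens L K)
  tens_lieDl tens_lieDr tens_lieZl tens_lieZr tens_liexx tens_jacobi.

Lemma lie_pure x a y b : lie (pure x a) (pure y b) = pure (lie x y) (a * b).
Proof. exact: tlie_pure. Qed.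

End Lie.
End Tensor.

(** The subspace [S (x) K] of [L (x) K], see [base_changeE]. *)
Definition base_change (k : fieldType) (L : lmodType k) (K : fieldExtType k)
  (S : set L) : set (tens L K) := [set t | forall i, S (tens_coef t i)].
Arguments base_change {k L} K S.

Lemma base_changeE (k : fieldType) (L : lmodType k) (K : fieldExtType k)
  (S : set L) : subspace S ->
  base_change K S = lspan [set pure x a | x in S & a in [set: K]].
Proof.
move=> [S0 Slin].
have SZ (c : k) x : S x -> S (c *: x).
  by move=> Sx; rewrite -[_ *: _]addr0; exact: Slin.
have SD x y : S x -> S y -> S (x + y).
  by move=> Sx Sy; rewrite -[x]scale1r; exact: Slin.
apply/seteqP; split=> t.
  move=> St A [[A0 Alin] SA]; rewrite [t]tensE.
  have AD x y : A x -> A y -> A (x + y).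
    by move=> Ax Ay; rewrite -[x]scale1r; exact: Alin.
  apply: (big_ind A) => // i _; apply: SA.
  by exists (tens_coef t i); [exact: St | exists (vbasis {:K})`_i].
move=> /(_ (base_change K S)); apply; split; first split.
- by move=> i; rewrite tens_coef0.
- move=> a u w Su Sw i; rewrite tens_coefD; apply: (SD); last exact: Sw.
  rewrite [u]tensE scaler_sumr tens_coef_sum.
  apply: (big_ind S) => // j _; rewrite scale_pure tens_coef_pure.
  by apply: SZ; exact: Su.
- by move=> w [x Sx [a _ <-]] i; rewrite tens_coef_pure; apply: SZ.
Qed.

(** The Pluecker coordinates are indexed by all maps ['I_r -> 'I_d], not only
    by the increasing ones: the extra coordinates are zero or equal up to sign
    to a usual one, so homogeneous equations cut out the same closed sets. *)
Definition plucker_dim (d r : nat) : nat := #|{ffun 'I_r -> 'I_d}|.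

Definition plucker (K : fieldType) (d r : nat) (b : r.-tuple 'rV[K]_d)
  (j : 'I_(plucker_dim d r)) : K :=
  \det (\matrix_(i < r, i' < r) tnth b i 0 ((enum_val j : {ffun 'I_r -> 'I_d}) i')).

(** A constructible subset of the variety, over [k], of all linear subspaces of
    a [d]-dimensional space (the disjoint union of the [Gr(r, d)]) is a boolean
    combination of closed subsets of the components [Gr(r, d)] defined by
    homogeneous equations in the Pluecker coordinates. *)
Inductive constructible_set (k : fieldType) (d : nat) : Type :=
| CZero r m (p : {mpoly k[plucker_dim d r]}) of p \is m.-homog
| CCompl of constructible_set k d
| CUnion of constructible_set k d & constructible_set k d.

(** The [K]-points; those of the whole variety are the subspaces of [K^d]. *)
Fixpoint points (k : fieldType) (d : nat) (C : constructible_set k d)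
  (K : fieldExtType k) : set {vspace 'rV[K]_d} :=
  match C with
  | CZero r _ p _ => [set U | exists b : r.-tuple 'rV[K]_d,
      basis_of U b /\ (map_mpoly (in_alg K) p).@[plucker b] = 0]
  | CCompl C1 => ~` @points k d C1 K
  | CUnion C1 C2 => @points k d C1 K `|` @points k d C2 K
  end.
Arguments points {k d} C K.

Section Classes.
Variables (k : fieldType) (L : lieAlgType k).

Record subalg_class := SubalgClass {
  members :> forall K : fieldExtType k, set (set (tens L K));
  members_subalgebra : forall K H, @members K H -> subalgebra H
}.
Arguments members X K _ : rename.

(** The subspace of [L (x) K] between [B (x) K] and [A (x) K] corresponding to
    the subspace [U] of [K^d = (A/B) (x) K], the latter identification being
    given by a basis [v] of [A] modulo [B]. *)
Definition pullback (B : set L) d (v : 'I_d -> L) (K : fieldExtType k)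
  (U : {vspace 'rV[K]_d}) : set (tens L K) :=
  [set t | exists2 c : 'rV[K]_d, c \in U &
     base_change K B (t - \sum_i c 0 i *: pure (v i) 1)].

(** [Y] is the set of points of a constructible subset of [Gr(A/B)].  This does
    not depend on the basis [v], since a change of basis is a [k]-automorphism
    of the Grassmannian. *)
Definition constructible_in (A B : set L)
  (Y : forall K : fieldExtType k, set (set (tens L K))) : Prop :=
  forall d (v : 'I_d -> L), basis_mod A B v ->
  exists C : constructible_set k d, forall K : fieldExtType k,
    Y K = [set pullback B v U | U in points C K].

(** The notions common to the two kinds of filtrations: [cod] is the relevant
    notion of codimension, and the members of the class containing [bot l] and
    contained in [top l] are parametrised by [Gr(top l / bot l)]. *)
Section Stable.
Variables (bot top : nat -> set L).
Variable cod : forall K : fieldExtType k, set (tens L K) -> nat -> Prop.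
Variable X : subalg_class.

Definition codim_part (n : nat) (K : fieldExtType k) : set (set (tens L K)) :=
  [set H | X K H /\ cod H n].
Arguments codim_part n K _ : clear implicits.

Definition codim_part_over (l n : nat) (K : fieldExtType k) :
    set (set (tens L K)) :=
  [set H | codim_part n K H /\ base_change K (bot l) `<=` H].
Arguments codim_part_over l n K _ : clear implicits.

Definition constructible_class : Prop :=
  forall l n, constructible_in (top l) (bot l) (fun K =>
    [set H | codim_part_over l n K H /\ H `<=` base_change K (top l)]).

Definition stable_class : Prop :=
  constructible_class /\
  forall n, exists l, forall j, (l <= j)%N -> forall K : fieldExtType k,
    codim_part_over l n K = codim_part_over j n K.

End Stable.

Definition closed_in (I : Type) (F : I -> set L) (K : fieldExtType k)
  (H : set (tens L K)) : Prop :=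
  H = \bigcap_(j in [set: I]) [set x + y | x in H & y in base_change K (F j)].

Lemma Xle_subalgebra (I : Type) (F : I -> set L) (K : fieldExtType k)
  (H : set (tens L K)) : closed_in F H /\ subalgebra H -> subalgebra H.
Proof. by case. Qed.

Definition Xle (I : Type) (F : I -> set L) : subalg_class :=
  @SubalgClass (fun K => [set H | closed_in F H /\ subalgebra H])
    (@Xle_subalgebra I F).

Lemma Xideal_subalgebra (I : Type) (F : I -> set L) (K : fieldExtType k)
  (H : set (tens L K)) : Xle F K H /\ lie_ideal H -> subalgebra H.
Proof. by case=> _ /ideal_subalgebra. Qed.

Definition Xideal (I : Type) (F : I -> set L) : subalg_class :=
  @SubalgClass (fun K => [set H | Xle F K H /\ lie_ideal H])
    (@Xideal_subalgebra I F).

Definition well_covered (F : nat -> set L) : Prop :=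
  forall n, exists f, exists s : seq nat,
    [/\ uniq s, size s = n.+1 &
        forall i, i \in s ->
          (2 * i < f)%N /\ F f = lie_prod (F i) (F (f - i)%N)].

Record N_filtration (F : nat -> set L) : Prop := {
  N_subspace : forall i, subspace (F i);
  N_full : F 0%N = [set: L];
  N_decr : forall i, F i.+1 `<=` F i;
  N_fincodim : forall i, fincodim [set: L] (F i);
  N_lie : forall i j, lie_prod (F i) (F j) `<=` F (i + j)%N;
  N_separated : \bigcap_(i in [set: nat]) F i = [set 0]
}.

Definition N_stable (F : nat -> set L) (X : subalg_class) : Prop :=
  stable_class F (fun _ => [set: L])
    (fun K H n => codim [set: tens L K] H n) X.

Record Z_filtration (F : int -> set L) : Prop := {
  Z_subspace : forall i, subspace (F i);
  Z_decr : forall i, F (i + 1) `<=` F i;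
  Z_lie : forall i j, lie_prod (F i) (F j) `<=` F (i + j);
  Z_commensurable : forall j, commensurable (F j) (F 0);
  Z_exhaustive : \bigcup_(j in [set: int]) F j = [set: L];
  Z_separated : \bigcap_(j in [set: int]) F j = [set 0]
}.

(** Brackets in the subalgebra [F 0] are those of [L], so well-coveredness of
    the positive part is a property of its filtration inside [L]. *)
Definition positive_part (F : int -> set L) : nat -> set L := fun j => F j%:Z.

Definition Z_well_covered (F : int -> set L) : Prop :=
  well_covered (positive_part F).

Lemma X0le_subalgebra (F : int -> set L) (K : fieldExtType k)
  (H : set (tens L K)) :
  Xle F K H /\ commensurable H (base_change K (F 0)) -> subalgebra H.
Proof. by case=> -[]. Qed.

Definition X0le (F : int -> set L) : subalg_class :=
  @SubalgClass
    (fun K => [set H | Xle F K H /\ commensurable H (base_change K (F 0))])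
    (@X0le_subalgebra F).

Definition Z_stable (F : int -> set L) (X : subalg_class) : Prop :=
  stable_class (fun l => F l%:Z) (fun l => F (- l%:Z))
    (fun K H n => codim_sum H (base_change K (F 0)) n) X.

End Classes.

(* Main.v *)
From HB Require Import structures.
Require Import Defs.
From mathcomp Require Import all_boot all_order all_algebra all_field.
From mathcomp Require Import mpoly.
From mathcomp Require Import boolp classical_sets.
From mathcomp Require Import zify.

Set Implicit Arguments.
Unset Strict Implicit.
Unset Printing Implicit Defensive.

Import Order.TTheory GRing.Theory Num.Theory.
Local Open Scope classical_set_scope.
Local Open Scope ring_scope.

(** The proof has two independent parts.

    Stability. Let [H] be a subalgebra of codimension at most [n] in the
    positive part which contains some term of the filtration. Then [H] contains
    a term depending on [n] only ([well_covered_bound]). This goes by induction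
    on [n]: if [F M] is the last term not contained in [H], then [H + F M] is
    again a subalgebra, since [F M] is an ideal of [F 0], and its codimension is
    smaller, so it contains a known term [F l]. Well-coveredness provides [f]
    and an index [i] with [l < i < f - i] such that brackets of [F i] with
    [F (f - i)] span [F f]. If [f <= M], both [F i] and [F (f - i)] lie in
    [H + F M], so their brackets are brackets of elements of [H] up to elements
    of [F (M + 1)], which lie in [H] as well. Hence [H] contains [F f].

    Constructibility. A subspace between [B (x) K] and [A (x) K] is given by a
    subspace [U] of [K^d], where [d] is the dimension of [A / B]. For a sequence
    [f] of [r] coordinates, replacing one entry of [f] by a variable one turns
    the Pluecker coordinates of an [r]-dimensional [U] into an [r * d] matrix
    [chart f], whose rows lie in [U], and span [U] as soon as the coordinate
    indexed by [f] is nonzero ([chart_eval], [chart_full]). All the conditions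
    needed can be expressed by bounds on ranks of matrices made of these
    matrices and of structure constants in [k], that is by the vanishing of
    homogeneous polynomials in the Pluecker coordinates ([constructible_rank]):
    that brackets of elements of [U] stay in [U]
    ([constructible_bilinear], [constructible_linear]), and the dimension of the
    intersection of [U] with a subspace defined over [k], on which the
    codimension depends ([constructible_dims]).

    In the Z-filtered case the brackets of [F (- l)] with itself may
    leave [F (- l)], but stay in [F (- 2 l)]; the condition that they lie in the
    subalgebra is read in [F (- 2 l) / F l]. Moreover [F l] need not be an
    ideal; its brackets with [F (- l)] are tested on the finite-dimensional quotient
    [F l / F (2 l)], because brackets of [F (- l)] with [F (2 l)] lie in [F l]. *)

(** * Subspaces as sets, coordinates and codimension *)

Section SetSubspaces.
Variables (k : fieldType) (M : lmodType k).
Implicit Types A B C S : set M.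

Lemma subspaceD A x y : subspace A -> A x -> A y -> A (x + y).
Proof. by move=> [_ h] Ax Ay; rewrite -[x]scale1r; exact: h. Qed.

Lemma subspaceZ A a x : subspace A -> A x -> A (a *: x).
Proof. by move=> [A0 h] Ax; rewrite -[_ *: _]addr0; exact: h. Qed.

Lemma subspaceN A x : subspace A -> A x -> A (- x).
Proof. by move=> sA Ax; rewrite -scaleN1r; exact: subspaceZ. Qed.

Lemma subspaceB A x y : subspace A -> A x -> A y -> A (x - y).
Proof. by move=> sA Ax Ay; apply: subspaceD => //; exact: subspaceN. Qed.

Lemma subspace_sum A (I : Type) (s : seq I) (P : pred I) (F : I -> M) :
  subspace A -> (forall i, P i -> A (F i)) -> A (\sum_(i <- s | P i) F i).
Proof.
move=> sA AF; apply: big_ind => //; first by case: sA.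
by move=> x y; exact: subspaceD.
Qed.

Lemma subspaceDl A x y : subspace A -> A y -> A (x + y) <-> A x.
Proof.
move=> sA Ay; split=> [h|h]; last exact: subspaceD.
by rewrite -[x](addrK y); exact: subspaceB.
Qed.

Lemma subspace_congr A x y : subspace A -> A (x - y) -> A x <-> A y.
Proof. by move=> sA h; rewrite -(subspaceDl y sA h) addrC subrK. Qed.

Lemma subspaceT : subspace [set: M].
Proof. by []. Qed.

Lemma subspaceI A B : subspace A -> subspace B -> subspace (A `&` B).
Proof.
move=> sA sB; split; first by split; [case: sA|case: sB].
move=> a x y [Ax Bx] [Ay By].
by split; apply: subspaceD => //; exact: subspaceZ.
Qed.

Lemma subspace_lspan S : subspace (lspan S).
Proof.
split; first by move=> A [[A0 _] _].
move=> a x y hx hy A hA; case: (hA) => sA _.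
by apply: subspaceD => //; [apply: subspaceZ => //; exact: hx|exact: hy].
Qed.

Lemma lspan_min A S : subspace A -> S `<=` A -> lspan S `<=` A.
Proof. by move=> sA SA; exact: smallest_sub. Qed.

Definition setsum A B : set M := [set x + y | x in A & y in B].

Lemma subspace_setsum A B : subspace A -> subspace B -> subspace (setsum A B).
Proof.
move=> sA sB; split; first by exists 0; [case: sA|exists 0; [case: sB|rewrite addr0]].
move=> a _ _ [x Ax [y By <-]] [x' Ax' [y' By' <-]].
exists (a *: x + x'); first by case: sA => _; exact.
by exists (a *: y + y'); [case: sB => _; exact|rewrite scalerDr addrACA].
Qed.

Lemma setsum_subl A B : subspace B -> A `<=` setsum A B.
Proof. by move=> [B0 _] x Ax; exists x => //; exists 0 => //; rewrite addr0. Qed.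

Lemma setsum_subr A B : subspace A -> B `<=` setsum A B.
Proof. by move=> [A0 _] x Bx; exists 0 => //; exists x => //; rewrite add0r. Qed.

Lemma setsum_min A B C : subspace C -> A `<=` C -> B `<=` C -> setsum A B `<=` C.
Proof. by move=> sC AC BC _ [x /AC Cx [y /BC Cy <-]]; exact: subspaceD. Qed.

End SetSubspaces.

(** Among the subspaces contained in [S], one of maximal dimension is all of
    [S], since adjoining a further vector of [S] would enlarge it. *)
Lemma subspace_vspace (k : fieldType) (V : vectType k) (S : set V) :
  subspace S -> exists U : {vspace V}, forall x, x \in U <-> S x.
Proof.
move=> sS.
pose P n := `[< exists U : {vspace V}, (forall x, x \in U -> S x) /\ \dim U = n >].
have exP : exists n, P n.
  exists 0%N; apply/asboolP; exists 0%VS; split; last exact: dimv0.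
  by move=> x; rewrite memv0 => /eqP->; case: sS.
have ubP n : P n -> (n <= dim V)%N.
  by move=> /asboolP[U [_ <-]]; rewrite -dimvf; exact: dimvS (subvf U).
case: (ex_maxnP exP ubP) => n /asboolP[U [US dU]] maxn.
exists U => x; split=> [|Sx]; first exact: US.
have PU : P (\dim (U + <[x]>)%VS).
  apply/asboolP; exists (U + <[x]>)%VS; split=> // z /memv_addP[u /US Su [y]].
  by move=> /vlineP[a ->] ->; apply: subspaceD => //; exact: subspaceZ.
have := maxn _ PU; rewrite -dU => le_dim.
have /eqP -> : U == (U + <[x]>)%VS by rewrite eqEdim addvSl.
by rewrite memvE addvSr.
Qed.

Section Coordinates.
Variables (k : fieldType) (M : lmodType k).
Implicit Types A B C S : set M.

Definition lincomb d (v : 'I_d -> M) (c : 'rV[k]_d) : M := \sum_i c 0 i *: v i.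

Section Lincomb.
Variables (d : nat) (v : 'I_d -> M).

Lemma lincombD c c' : lincomb v (c + c') = lincomb v c + lincomb v c'.
Proof.
by rewrite /lincomb -big_split; apply: eq_bigr => i _; rewrite mxE scalerDl.
Qed.

Lemma lincombZ a c : lincomb v (a *: c) = a *: lincomb v c.
Proof.
by rewrite /lincomb scaler_sumr; apply: eq_bigr => i _; rewrite mxE scalerA.
Qed.

Lemma lincombB c c' : lincomb v (c - c') = lincomb v c - lincomb v c'.
Proof. by rewrite lincombD -[- c']scaleN1r lincombZ scaleN1r. Qed.

Lemma lincomb0 : lincomb v 0 = 0.
Proof. by have := lincombZ 0 0; rewrite !scale0r. Qed.

Lemma lincomb_delta i : lincomb v (delta_mx 0 i) = v i.
Proof.
rewrite /lincomb (bigD1 i) //= big1 ?addr0 => [|j ji].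
  by rewrite mxE !eqxx scale1r.
by rewrite mxE eqxx (negPf ji) scale0r.
Qed.

Lemma lincomb_in A c : subspace A -> (forall i, A (v i)) -> A (lincomb v c).
Proof. by move=> sA Av; apply: subspace_sum => // i _; exact: subspaceZ. Qed.

End Lincomb.

(** If the [v i] have coordinates the rows of [P] with respect to [w] modulo
    [B], then [c] and [c *m P] are coordinates of the same vector. *)
Lemma lincomb_mulmx B d e (v : 'I_d -> M) (w : 'I_e -> M) (P : 'M[k]_(d, e)) c :
  subspace B -> (forall i, B (v i - lincomb w (row i P))) ->
  B (lincomb v c - lincomb w (c *m P)).
Proof.
move=> sB h.
have -> : lincomb v c - lincomb w (c *m P) =
    \sum_i c 0 i *: (v i - lincomb w (row i P)).
  rewrite mulmx_sum_row (big_morph _ (lincombD w) (lincomb0 w)) -sumrB.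
  by apply: eq_bigr => i _; rewrite lincombZ scalerBr.
by apply: subspace_sum => // i _; exact: subspaceZ.
Qed.

Section BasisMod.
Variables (A B : set M) (d : nat) (v : 'I_d -> M).
Hypotheses (sA : subspace A) (sB : subspace B) (vP : basis_mod A B v).

Lemma basis_mod_sub : B `<=` A. Proof. by case: vP. Qed.

Lemma basis_mod_in i : A (v i). Proof. by case: vP. Qed.

Lemma basis_mod_coord x : A x -> exists c, B (x - lincomb v c).
Proof. by case: vP => _ _ h /h[c [hc _]]; exists c. Qed.

Lemma basis_mod_free c : B (lincomb v c) <-> c = 0.
Proof.
split=> [Bc|->]; last by rewrite lincomb0; case: sB.
case: vP => _ _ /(_ 0)[|c0 [_ uniq_c0]]; first by case: sA.
rewrite -(uniq_c0 0); first apply/esym/uniq_c0.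
  by rewrite sub0r; exact: subspaceN.
by rewrite (lincomb0 v : \sum_i _ = 0) subr0; case: sB.
Qed.

Lemma basis_mod_coords e (u : 'I_e -> M) : (forall i, A (u i)) ->
  exists P : 'M[k]_(e, d), forall i, B (u i - lincomb v (row i P)).
Proof.
move=> Au; have /(_ _)/cid co i : exists c, B (u i - lincomb v c).
  by apply: basis_mod_coord; exact: Au.
exists (\matrix_i sval (co i)) => i.
by rewrite rowK; exact: svalP (co i).
Qed.

End BasisMod.

Lemma basis_modI A B d (v : 'I_d -> M) :
  subspace B -> B `<=` A -> (forall i, A (v i)) ->
  (forall x, A x -> exists c, B (x - lincomb v c)) ->
  (forall c, B (lincomb v c) -> c = 0) -> basis_mod A B v.
Proof.
move=> sB BA Av span free; split=> // x /span[c hc]; exists c; split=> // c' hc'.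
apply/eqP; rewrite -subr_eq0; apply/eqP/free; rewrite lincombB.
rewrite -(subrKA x) addrC -[lincomb v c - x]opprB.
by apply: subspaceB.
Qed.

End Coordinates.

Section Pull.
Variables (k : fieldType) (M : lmodType k).
Implicit Types A B C S : set M.

(** The subspace of [A] containing [B] that corresponds to [U] under the
    identification of [A / B] with [k^d]. *)
Definition pull B d (v : 'I_d -> M) (U : {vspace 'rV[k]_d}) : set M :=
  [set t | exists2 c, c \in U & B (t - lincomb v c)].

Section PullTheory.
Variables (A B : set M) (d : nat) (v : 'I_d -> M).
Hypotheses (sA : subspace A) (sB : subspace B) (vP : basis_mod A B v).
Implicit Types U : {vspace 'rV[k]_d}.

Lemma subspace_pull U : subspace (pull B v U).
Proof.
split; first by exists 0; rewrite ?mem0v // lincomb0 subr0; case: sB.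
move=> a x y [c Uc Bc] [c' Uc' Bc']; exists (a *: c + c').
  by rewrite memvD // memvZ.
rewrite lincombD lincombZ opprD addrACA -scalerBr.
by case: sB => _; exact.
Qed.

Lemma pull_ge U : B `<=` pull B v U.
Proof. by move=> x Bx; exists 0; rewrite ?mem0v // lincomb0 subr0. Qed.

Lemma pull_le U : pull B v U `<=` A.
Proof.
move=> x [c _ Bc]; rewrite -[x](subrK (lincomb v c)); apply: subspaceD => //.
  exact: (basis_mod_sub vP).
by apply: lincomb_in => // i; exact: (basis_mod_in vP).
Qed.

Lemma pull_lincomb U c : pull B v U (lincomb v c) <-> c \in U.
Proof.
split=> [[c' Uc']|Uc]; last by exists c => //; rewrite subrr; case: sB.
by rewrite -lincombB => /(basis_mod_free sA sB vP)/eqP; rewrite subr_eq0 => /eqP->.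
Qed.

Lemma pullP U x c : B (x - lincomb v c) -> pull B v U x <-> c \in U.
Proof.
move=> Bxc; rewrite -pull_lincomb; apply: subspace_congr; first exact: subspace_pull.
exact: pull_ge.
Qed.

Lemma pull_surj S : subspace S -> B `<=` S -> S `<=` A ->
  exists U, S = pull B v U.
Proof.
move=> sS BS SA.
have [|U UP] := @subspace_vspace _ 'rV[k]_d [set c | S (lincomb v c)].
  split; first by rewrite /= lincomb0; case: sS.
  by move=> a x y /= Sx Sy; rewrite lincombD lincombZ; case: sS => _; exact.
exists U; apply/seteqP; split=> x.
  move=> Sx; have [c hc] := basis_mod_coord vP (SA _ Sx).
  by exists c => //; apply/UP; apply/(subspace_congr sS (BS _ hc)).
by move=> [c /UP Sc /BS hc]; apply/(subspace_congr sS hc).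
Qed.

Lemma pullI U U' : pull B v U `&` pull B v U' = pull B v (U :&: U')%VS.
Proof.
apply/seteqP; split=> x.
  by move=> [[c Uc hc] /(pullP _ hc) U'c]; exists c => //; rewrite memv_cap Uc.
by move=> [c]; rewrite memv_cap => /andP[Uc U'c] hc; split; exists c.
Qed.

Lemma pullT : pull B v fullv = A.
Proof.
apply/seteqP; split; first exact: pull_le.
by move=> x /(basis_mod_coord vP)[c hc]; exists c => //; exact: memvf.
Qed.

Lemma pull0 : pull B v 0%VS = B.
Proof.
apply/seteqP; split; last exact: pull_ge.
by move=> x [c]; rewrite memv0 => /eqP->; rewrite lincomb0 subr0.
Qed.

Lemma pull_codim U U' : (U' <= U)%VS ->
  codim (pull B v U) (pull B v U') (\dim U - \dim U').
Proof.
move=> U'U; set W := (U :\: U')%VS.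
have dW : \dim W = (\dim U - \dim U')%N.
  by have := dimv_cap_compl U U'; rewrite (capv_idPr U'U) => <-; rewrite addKn.
rewrite -dW; pose w := vbasis W; have wP : basis_of W w by exact: vbasisP.
pose u i := lincomb v w`_i; exists u.
have uE c : lincomb u c = lincomb v (\sum_i c 0 i *: w`_i).
  rewrite (big_morph _ (lincombD v) (lincomb0 v)).
  by apply: eq_bigr => i _; rewrite lincombZ.
have Ww i : (i < \dim W)%N -> w`_i \in W.
  by move=> ltiW; apply: vbasis_mem; rewrite mem_nth // size_tuple.
apply: basis_modI.
- exact: subspace_pull.
- by move=> x [c U'c hc]; exists c => //; exact: (subvP U'U).
- by move=> i; apply/pull_lincomb; apply: (subvP (diffvSl U U')); exact: Ww.
- move=> x [c Uc hc].
  have : c \in (W + U :&: U')%VS by rewrite addv_diff_cap.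
  move=> /memv_addP[c1 Wc1 [c2]]; rewrite memv_cap => /andP[_ U'c2] cE.
  exists (\row_i coord w i c1); rewrite uE.
  under eq_bigr do rewrite mxE.
  rewrite -(coord_basis wP Wc1); exists c2 => //.
  by rewrite -addrA -opprD -lincombD -cE.
- move=> c; rewrite uE => /pull_lincomb U'c.
  have /freeP cfree := basis_free wP.
  apply/rowP => i; rewrite mxE; apply: cfree.
  apply/eqP; rewrite -memv0 -(capv_diff U U') memv_cap U'c andbT.
  by apply: memv_suml => j _; rewrite memvZ // Ww.
Qed.

End PullTheory.

(** Coordinates with respect to a second basis embed ['rV_n] into ['rV_m]. *)
Lemma codim_unique A B m n :
  subspace A -> subspace B -> codim A B m -> codim A B n -> m = n.
Proof.
move=> sA sB.
suff le p q : codim A B p -> codim A B q -> (p <= q)%N.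
  by move=> Am An; apply/eqP; rewrite eqn_leq !le.
move=> [v vP] [w wP].
have [P hP] := basis_mod_coords wP (basis_mod_in vP).
suff /eqP <- : row_free P by exact: rank_leq_col.
rewrite -kermx_eq0; apply/rowV0P => c /sub_kermxP cP0.
apply/(basis_mod_free sA sB vP).
by have := lincomb_mulmx c sB hP; rewrite cP0 lincomb0 subr0.
Qed.

Lemma pull_codimE A B d (v : 'I_d -> M) U U' n :
  subspace A -> subspace B -> basis_mod A B v -> (U' <= U)%VS ->
  codim (pull B v U) (pull B v U') n <-> n = (\dim U - \dim U')%N.
Proof.
move=> sA sB vP U'U; split=> [|->]; last exact: pull_codim vP _ _ U'U.
by move=> h; apply: codim_unique h (pull_codim sA sB vP U'U); exact: subspace_pull.
Qed.

(** In coordinates [C] is a subspace [U] of [k^m], and its codimension in [A] is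
    [m - \dim U]. *)
Lemma codim_le A B C m : subspace A -> subspace B -> subspace C ->
  B `<=` C -> C `<=` A -> codim A B m ->
  exists2 n, codim A C n & (n <= m)%N /\ (n = m -> C = B).
Proof.
move=> sA sB sC BC CA [v vP].
have [U CE] := pull_surj vP sC BC CA.
have := pull_codim sA sB vP (subvf U).
rewrite (pullT sA vP) -CE dimvf /dim /= mul1n => h.
exists (m - \dim U)%N => //; split=> [|e]; first exact: leq_subr.
have leUm : (\dim U <= m)%N.
  by have := dimvS (subvf U); rewrite dimvf /dim /= mul1n.
have U0 : U = 0%VS.
  by apply/eqP; rewrite -dimv_eq0 -(eqn_add2l (m - \dim U)) subnK // addn0 e.
by rewrite CE U0 pull0.
Qed.

Lemma fincodim_subl A B C : subspace A -> subspace B -> subspace C ->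
  C `<=` B -> B `<=` A -> fincodim A C -> fincodim B C.
Proof.
move=> sA sB sC CB BA [d [v vP]].
have [U ->] := pull_surj vP sB CB BA.
have := pull_codim sA sC vP (sub0v U); rewrite pull0 // => h.
by exists (\dim U - \dim (0%VS : {vspace 'rV[k]_d}))%N.
Qed.

Lemma fincodim_trans A B C : subspace A -> subspace B -> subspace C ->
  fincodim A B -> fincodim B C -> fincodim A C.
Proof.
move=> sA sB sC [m [v vP]] [n [w wP]].
exists (m + n)%N.
exists (fun i => match split i with inl i => v i | inr i => w i end).
have lcE c : lincomb (fun i => match split i with inl i => v i | inr i => w i end) c
    = lincomb v (lsubmx c) + lincomb w (rsubmx c).
  rewrite /lincomb big_split_ord /=; congr (_ + _); apply: eq_bigr => i _.
    by rewrite mxE (unsplitK (inl i)).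
  by rewrite mxE (unsplitK (inr i)).
have AB := basis_mod_sub vP; have BC := basis_mod_sub wP.
apply: basis_modI => //.
- by move=> x /BC/AB.
- move=> i; case: split => j; first exact: (basis_mod_in vP).
  exact/AB/(basis_mod_in wP).
- move=> x /(basis_mod_coord vP)[c /(basis_mod_coord wP)[c' h]].
  by exists (row_mx c c'); rewrite lcE row_mxKl row_mxKr opprD addrA.
- move=> c; rewrite lcE => h.
  have c0 : lsubmx c = 0.
    apply/(basis_mod_free sA sB vP)/(@subspaceDl _ _ _ _ (lincomb w (rsubmx c))) => //.
      by apply: lincomb_in => // i; exact: (basis_mod_in wP).
    exact: BC.
  have c1 : rsubmx c = 0.
    by apply/(basis_mod_free sB sC wP); rewrite c0 lincomb0 add0r in h.
  by rewrite -[c]hsubmxK c0 c1 row_mx0.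
Qed.

End Pull.

(** * Extension of scalars *)

Section BaseChange.
Variables (k : fieldType) (K : fieldExtType k).

Definition pures (L : lmodType k) d (v : 'I_d -> L) (i : 'I_d) : tens L K :=
  pure (v i) 1.

Section Module.
Variable L : lmodType k.
Implicit Types (A B S : set L) (H : set (tens L K)).

Lemma pureE (x : L) (a : K) : pure x a = a *: pure x 1.
Proof. by rewrite scale_pure mulr1. Qed.

Lemma pure_scaler (a : k) (x : L) : pure (a *: x) 1 = in_alg K a *: pure x 1.
Proof. by rewrite pureZ pureE. Qed.

Lemma pure_lincomb d (v : 'I_d -> L) (c : 'rV_d) :
  pure (lincomb v c) 1 = lincomb (pures v) (map_mx (in_alg K) c).
Proof.
rewrite /lincomb pure_suml; apply: eq_bigr => i _.
by rewrite pure_scaler mxE.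
Qed.

Lemma pureB (x y : L) (a : K) : pure (x - y) a = pure x a - pure y a.
Proof. by rewrite pureDl -[- y]scaleN1r pureZ scaleN1r -[- a]mulN1r -scale_pure scaleN1r. Qed.

Lemma subspace_base_change S : subspace S -> subspace (base_change K S).
Proof. by move=> sS; rewrite base_changeE //; exact: subspace_lspan. Qed.

Lemma base_change_pure S x a : subspace S -> S x -> base_change K S (pure x a).
Proof. by move=> sS Sx i; rewrite tens_coef_pure; exact: subspaceZ. Qed.

Lemma base_changeS A B : A `<=` B -> base_change K A `<=` base_change K B.
Proof. by move=> AB t At i; exact: AB. Qed.

Lemma base_changeT : base_change K [set: L] = [set: tens L K].
Proof. by apply/seteqP; split. Qed.

Lemma base_change_min S H : subspace H ->
  (forall x, S x -> H (pure x 1)) -> base_change K S `<=` H.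
Proof.
move=> sH SH t St; rewrite [t]tensE; apply: subspace_sum => // i _.
by rewrite pureE; apply: subspaceZ => //; exact: SH.
Qed.

Lemma subspace_pure_preimage H : subspace H ->
  subspace [set x : L | H (pure x 1)].
Proof.
move=> sH; split=> [|a x y /= Hx Hy]; first by rewrite /= pure0l; case: sH.
by rewrite pureDl pure_scaler; case: sH => _; exact.
Qed.

(** The coordinate families of the coefficients [tens_coef t i] assemble into
    coordinates of [t]; conversely coordinates over [K] are determined by
    their components in [k], on which uniqueness over [k] applies. *)
Lemma basis_mod_base_change A B d (v : 'I_d -> L) :
  subspace A -> subspace B -> basis_mod A B v ->
  basis_mod (base_change K A) (base_change K B) (pures v).
Proof.
move=> sA sB vP; have sBK := subspace_base_change sB.
apply: basis_modI => //.
- by apply: base_changeS; exact: (basis_mod_sub vP).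
- by move=> i; apply: base_change_pure => //; exact: (basis_mod_in vP).
- move=> x Ax.
  suff [c _ hc] : pull (base_change K B) (pures v) fullv x by exists c.
  apply: base_change_min Ax; first exact: subspace_pull.
  move=> y /(basis_mod_coord vP)[c hc]; exists (map_mx (in_alg K) c).
    exact: memvf.
  by rewrite -pure_lincomb -pureB; exact: base_change_pure.
- move=> c Bc; apply/rowP => i; rewrite mxE.
  rewrite [c 0 i](coord_vbasis (memvf _)) big1 // => j _.
  suff /rowP/(_ i) : \row_i coord (vbasis {:K}) j (c 0 i) = 0.
    by rewrite !mxE => ->; rewrite scale0r.
  apply/(basis_mod_free sA sB vP).
  have := Bc j; rewrite /lincomb tens_coef_sum => /(eq_rect _ B); apply.
  by apply: eq_bigr => l _; rewrite -pureE tens_coef_pure mxE.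
Qed.

Lemma base_change_coords B d e (v : 'I_d -> L) (w : 'I_e -> L)
    (P : 'M[k]_(d, e)) c :
  subspace B -> (forall i, B (v i - lincomb w (row i P))) ->
  base_change K B (lincomb (pures v) c -
    lincomb (pures w) (c *m map_mx (in_alg K) P)).
Proof.
move=> sB h; apply: lincomb_mulmx; first exact: subspace_base_change.
by move=> i; rewrite -map_row -pure_lincomb -pureB; exact: base_change_pure.
Qed.

End Module.

Lemma lie_prod_in (L : lieAlgType k) (A B : set L) x y :
  A x -> B y -> lie_prod A B (lie x y).
Proof. by move=> Ax By; apply: sub_gen_smallest; exists x => //; exists y. Qed.

Lemma base_change_lie (L : lieAlgType k) (A B C : set L) t u : subspace C ->
  lie_prod A B `<=` C -> base_change K A t -> base_change K B u ->
  base_change K C (lie t u).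
Proof.
move=> sC ABC At Bu; have sCK := subspace_base_change sC.
rewrite [t]tensE [u]tensE lie_suml; apply: subspace_sum => // i _.
rewrite lie_sumr; apply: subspace_sum => // j _; rewrite lie_pure.
apply: base_change_pure => //; apply: ABC.
by apply: lie_prod_in; [exact: At|exact: Bu].
Qed.

End BaseChange.

(** * Stability *)

Lemma decr_subset T (F : nat -> set T) i j :
  (forall i, F i.+1 `<=` F i) -> (i <= j)%N -> F j `<=` F i.
Proof.
move=> dF /subnK <-; elim: (j - i)%N => //= n IH.
by rewrite addSn; apply: subset_trans IH; exact: dF.
Qed.

Lemma uniq_large n (s : seq nat) : uniq s -> size s = n.+1 ->
  exists2 i, i \in s & (n <= i)%N.
Proof.
move=> us ss; have [/hasP[i si le_ni]|/hasPn h] := boolP (has (leq n) s).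
  by exists i.
have : (size s <= size (iota 0 n))%N.
  apply: uniq_leq_size => // i /h; rewrite -ltnNge mem_iota add0n.
  by move=> ->.
by rewrite size_iota ss ltnn.
Qed.

(** The bound [f] is uniform because [l] comes from the induction hypothesis
    alone: it depends neither on [H] nor on the last term [F M] of the
    filtration that is not contained in [H]. *)
Lemma well_covered_bound (k : fieldType) (L : lieAlgType k) (F : nat -> set L) :
  (forall i, subspace (F i)) -> (forall i, F i.+1 `<=` F i) ->
  (forall i j, lie_prod (F i) (F j) `<=` F (i + j)%N) -> well_covered F ->
  forall n, exists l, forall (K : fieldExtType k) (H : set (tens L K)) j m,
    subalgebra H -> H `<=` base_change K (F 0%N) -> base_change K (F j) `<=` H ->
    codim (base_change K (F 0%N)) H m -> (m <= n)%N -> base_change K (F l) `<=` H.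
Proof.
move=> sF dF lF wF; elim=> [|n [l IH]].
  exists 0%N => K H j m [sH _] _ _ [v vP]; rewrite leqn0 => /eqP m0; subst m.
  move=> x /(basis_mod_coord vP)[c].
  by rewrite /lincomb big_ord0 subr0.
(* Among [l + 2] distinct indices one exceeds [l]; in particular it is positive,
   so that brackets with [F M] fall into [F (M + 1)]. *)
have [f [s [us ss sP]]] := wF l.+1.
have [i si lt_li] := uniq_large us ss.
have [lt_if Ff] := sP i si.
exists f => K H j m sH HF0 FjH Hm le_mn.
pose FK j := base_change K (F j).
have sFK p : subspace (FK p) by exact: subspace_base_change.
have dFK p q : (p <= q)%N -> FK q `<=` FK p.
  by move=> le_pq; apply: base_changeS; exact: decr_subset.
have lFK p q r x y : (r <= p + q)%N -> FK p x -> FK q y -> FK r (lie x y).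
  by move=> le_r px qy; apply: dFK le_r _ _; exact: base_change_lie (lF p q) px qy.
have exj : exists j, `[< FK j `<=` H >] by exists j; apply/asboolP.
case: (ex_minnP exj) => {j FjH exj} j /asboolP FjH minj.
have [le_jf|lt_fj] := leqP j f; first exact: subset_trans (dFK _ _ le_jf) FjH.
have {lt_fj} [M jE le_fM] : exists2 M, j = M.+1 & (f <= M)%N.
  by case: j lt_fj {FjH minj} => // M; exists M.
rewrite {}jE in FjH minj.
have nFMH : ~ FK M `<=` H by move=> /asboolP/minj; rewrite ltnn.
have [sbH lH] := sH.
have sH'K : subspace (setsum H (FK M)) by exact: subspace_setsum.
have FMH' : FK M `<=` setsum H (FK M) by exact: setsum_subr.
have HH' : H `<=` setsum H (FK M) by exact: setsum_subl.
have H'F0 : setsum H (FK M) `<=` FK 0%N.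
  exact: setsum_min (sFK 0%N) HF0 (dFK _ _ (leq0n M)).
(* [F M] is an ideal of [F 0]. *)
have sH' : subalgebra (setsum H (FK M)).
  split=> // _ _ [x Hx [y My <-]] [x' Hx' [y' My' <-]].
  rewrite lieDl lieDr -addrA; exists (lie x x'); first exact: lH.
  exists (lie x y' + lie y (x' + y')) => //; apply: (subspaceD (sFK M)).
    by apply: (lFK 0%N M) => //; exact: HF0.
  apply: (lFK M 0%N) => //; first by rewrite addn0.
  by apply: (subspaceD (sFK 0%N)); [exact: HF0|exact: dFK My'].
have [m' H'm' [le_m' eq_m']] := codim_le (sFK 0%N) sbH sH'K HH' H'F0 Hm.
have lt_m' : (m' < m)%N.
  rewrite ltn_neqAle le_m' andbT; apply/eqP => /eq_m' HE; apply: nFMH.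
  by rewrite -HE.
have FlH' : FK l `<=` setsum H (FK M).
  by apply: (IH K _ M m' sH' H'F0 FMH' H'm'); rewrite -ltnS; exact: leq_trans lt_m' le_mn.
have le_ifi : (i <= f - i)%N by lia.
have lt_iM : (i < M)%N by lia.
apply: (base_change_min sbH) => x; rewrite Ff => hx.
apply: (lspan_min (subspace_pure_preimage sbH)) hx.
move=> _ [a Fa [b Fb <-]] /=.
have -> : pure (lie a b) 1 = lie (pure a (1 : K)) (pure b 1).
  by rewrite lie_pure mulr1.
have Fia : FK i (pure a 1) by exact: base_change_pure.
have Fib : FK (f - i)%N (pure b 1) by exact: base_change_pure.
have [h Hh [z Mz e]] : setsum H (FK M) (pure a 1).
  by apply: FlH'; apply: dFK Fia; exact: ltnW.
have [h' Hh' [z' Mz' e']] : setsum H (FK M) (pure b 1).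
  by apply: FlH'; apply: dFK Fib; lia.
have Fih : FK i h.
  have -> : h = pure a 1 - z by rewrite -e addrK.
  by apply: (subspaceB (sFK i)) => //; apply: dFK Mz; exact: ltnW.
(* Here [h], [h'] lie in [H] and [z], [z'] in [F M]. Since [h] lies in [F i] as
   well, the terms involving [z] or [z'] have degree at least [M + 1]. *)
have -> : lie (pure a (1 : K)) (pure b 1) = lie h h' + (lie h z' + lie z (pure b 1)).
  by rewrite -e lieDl -[in LHS]e' lieDr -addrA e'.
apply: subspaceD => //; first exact: lH.
apply: FjH; apply: (subspaceD (sFK M.+1)).
  by apply: (lFK i M) => //; lia.
by apply: (lFK M (f - i)%N) => //; lia.
Qed.

(** * Constructible conditions on subspaces *)

Section Constructible.
Variables (k : fieldType) (d : nat).

Definition subspace_pred := forall K : fieldExtType k, set {vspace 'rV[K]_d}.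
Implicit Types P Q : subspace_pred.

Definition constructible_pred P :=
  exists C : constructible_set k d, forall K, points C K = P K.

Lemma constructible_ext P Q : constructible_pred P ->
  (forall K U, P K U <-> Q K U) -> constructible_pred Q.
Proof.
move=> [C CP] PQ; exists C => K; rewrite CP.
by apply/seteqP; split=> U /PQ.
Qed.

Lemma constructibleC P : constructible_pred P ->
  constructible_pred (fun K U => ~ P K U).
Proof. by move=> [C CP]; exists (CCompl C) => K; rewrite /= CP. Qed.

Lemma constructibleU P Q : constructible_pred P -> constructible_pred Q ->
  constructible_pred (fun K U => P K U \/ Q K U).
Proof. by move=> [C CP] [D DQ]; exists (CUnion C D) => K; rewrite /= CP DQ. Qed.

Lemma constructibleI P Q : constructible_pred P -> constructible_pred Q ->
  constructible_pred (fun K U => P K U /\ Q K U).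
Proof.
move=> cP cQ.
apply: (constructible_ext
  (constructibleC (constructibleU (constructibleC cP) (constructibleC cQ)))).
move=> K U; split=> [|[PU QU] []//].
by move=> /not_orP[/contrapT ? /contrapT ?].
Qed.

Lemma constructible_zero r m (p : {mpoly k[plucker_dim d r]}) :
  p \is m.-homog -> constructible_pred (fun K U => exists b : r.-tuple 'rV[K]_d,
    basis_of U b /\ (map_mpoly (in_alg K) p).@[plucker b] = 0).
Proof. by move=> hp; exists (CZero hp). Qed.

Lemma constructible_const (b : Prop) : constructible_pred (fun _ _ => b).
Proof.
have c0 := constructible_zero (dhomog0 k (@mdeg (plucker_dim d 0)) 0).
have [bT|bF] := pselect b.
  apply: constructible_ext (constructibleU c0 (constructibleC c0)) _ => K U.
  by split=> // _; exact: EM.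
apply: constructible_ext (constructibleI c0 (constructibleC c0)) _ => K U.
by split=> [[]|/bF].
Qed.

Lemma constructible_forall (I : finType) (P : I -> subspace_pred) :
  (forall i, constructible_pred (P i)) ->
  constructible_pred (fun K U => forall i, P i K U).
Proof.
move=> cP.
have cs (s : seq I) :
    constructible_pred (fun K U => forall i, i \in s -> P i K U).
  elim: s => [|a s IH].
    by apply: constructible_ext (constructible_const True) _ => K U; split.
  apply: constructible_ext (constructibleI (cP a) IH) _ => K U.
  split=> [[Pa Ps] i|h]; first by rewrite inE => /predU1P[->|/Ps].
  by split=> [|i si]; apply: h; rewrite inE ?eqxx ?si ?orbT.
apply: constructible_ext (cs (enum I)) _ => K U.
by split=> h i; [apply: h; rewrite mem_enum|move=> _].
Qed.

Lemma constructible_exists (I : finType) (P : I -> subspace_pred) :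
  (forall i, constructible_pred (P i)) ->
  constructible_pred (fun K U => exists i, P i K U).
Proof.
move=> cP.
apply: constructible_ext
  (constructibleC (constructible_forall (fun i => constructibleC (cP i)))) _.
move=> K U; split=> [/existsNP[i /contrapT]|[i Pi] h]; first by exists i.
exact: h Pi.
Qed.

Lemma constructible_dim (r : nat) : constructible_pred (fun K U => \dim U = r).
Proof.
apply: constructible_ext
  (constructible_zero (dhomog0 k (@mdeg (plucker_dim d r)) 0)) _.
move=> K U; split=> [[b [bU _]]|<-]; first exact: vector.size_basis bU.
exists (vbasis U); split; first exact: vbasisP.
by rewrite raddf0 meval0.
Qed.

End Constructible.

(** * Minors, homogeneous polynomials and Pluecker coordinates *)

Section MatrixFacts.
Variable F : fieldType.

(** A right inverse of [A], with its columns selected by [h], is a right inverse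
    of [rowsub h A]. *)
Lemma row_free_rowsub m n p (h : 'I_p -> 'I_m) (A : 'M[F]_(m, n)) :
  injective h -> row_free A -> row_free (rowsub h A).
Proof.
move=> hi /row_freeP[B AB]; apply/row_freeP; exists (B *m (rowsub h 1%:M)^T).
rewrite mulmxA mul_rowsub_mx AB; apply/matrixP => i j.
rewrite mxE (bigD1 (h i)) //= big1 ?addr0 => [|l li].
  by rewrite !mxE eqxx mul1r (inj_eq hi) eq_sym.
by rewrite !mxE eq_sym (negPf li) mul0r.
Qed.

Lemma unit_colsub r n (A : 'M[F]_(r, n)) : row_free A ->
  exists f : {ffun 'I_r -> 'I_n}, colsub f A \in unitmx.
Proof.
move=> Afree; have ATfull : row_full A^T by rewrite /row_full mxrank_tr.
exists (fullrankfun ATfull); have := fullrowsub_unit ATfull.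
by rewrite -trmx_mxsub unitmx_tr.
Qed.

(** For the converse, [s + 1] independent rows of [A] form a matrix of full rank,
    in which [s + 1] columns can be chosen independent. *)
Lemma rank_minors m n s (A : 'M[F]_(m, n)) : (\rank A <= s)%N <->
  forall (f : {ffun 'I_s.+1 -> 'I_m}) (g : {ffun 'I_s.+1 -> 'I_n}),
    \det (mxsub f g A) = 0.
Proof.
split=> [leAs f g|minors0].
  apply/eqP; apply: contraTT leAs => det_neq0; rewrite -ltnNge.
  have : mxsub f g A \in unitmx by rewrite unitmxE unitfE.
  rewrite -row_full_unit => /eqP <-.
  have -> : mxsub f g A = rowsub f 1%:M *m A *m colsub g 1%:M.
    by rewrite mulmx_colsub mulmx1 mul_rowsub_mx mul1mx -mxsubcr.
  exact: leq_trans (mxrankM_maxl _ _) (mxrankM_maxr _ _).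
rewrite leqNgt; apply/negP => lt_sA.
have Afree := maxrowsub_free A.
pose h : 'I_s.+1 -> 'I_(\rank A) := widen_ord lt_sA.
have hfree : row_free (rowsub h (rowsub (maxrankfun A) A)).
  by apply: row_free_rowsub => // i j /(congr1 val) /= /ord_inj.
have [g] := unit_colsub hfree.
rewrite -!mxsub_comp unitmxE unitfE => /eqP; apply.
rewrite -[RHS](minors0 [ffun i => maxrankfun A (h i)] g); congr (\det _).
by apply: eq_mxsub => // i; rewrite ffunE.
Qed.

End MatrixFacts.

Section HomogeneousMatrices.
Variables (R : comNzRingType) (n : nat).

Lemma dhomog_det m (M : 'M[{mpoly R[n]}]_m) (w : 'I_m -> nat) :
  (forall i j, M i j \is (w i).-homog) -> \det M \is (\sum_i w i)%N.-homog.
Proof.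
move=> hM; apply: rpred_sum => s _; rewrite rpredMsign.
by apply: (big_ind2 (fun p e => p \is e.-homog)) => //;
  [exact: dhomog1|move=> p e q f; exact: dhomogM].
Qed.

Lemma dhomog_mulmx m p q e f (A : 'M[{mpoly R[n]}]_(m, p))
    (B : 'M[{mpoly R[n]}]_(p, q)) :
  (forall i j, A i j \is e.-homog) -> (forall i j, B i j \is f.-homog) ->
  forall i j, (A *m B) i j \is (e + f).-homog.
Proof.
by move=> hA hB i j; rewrite mxE; apply: rpred_sum => l _; exact: dhomogM.
Qed.

Lemma dhomogC c : (c%:MP : {mpoly R[n]}) \is 0.-homog.
Proof. by rewrite -[c%:MP]mulr1 mul_mpolyC; apply: dhomogZ; exact: dhomog1. Qed.

Lemma meval_homog (p : {mpoly R[n]}) e (v : 'I_n -> R) c : p \is e.-homog ->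
  p.@[fun i => c * v i] = c ^+ e * p.@[v].
Proof.
move=> /dhomogP hp; rewrite !mevalE mulr_sumr; apply: eq_big_seq => m /hp hm.
have {e hp hm}-> : e = mdeg m by rewrite -hm.
rewrite mulrCA; congr (_ * _); rewrite mdegE -prodrXr -big_split /=.
by apply: eq_bigr => i _; rewrite exprMn.
Qed.

End HomogeneousMatrices.

Section BasisMatrix.
Variables (K : fieldType) (d r : nat) (b : r.-tuple 'rV[K]_d).
Variable U : {vspace 'rV[K]_d}.

Definition basis_mx : 'M[K]_(r, d) := \matrix_i tnth b i.

Lemma mulmx_basis_mx (x : 'rV_r) : x *m basis_mx = \sum_i x 0 i *: b`_i.
Proof. by rewrite mulmx_sum_row; apply: eq_bigr => i _; rewrite rowK (tnth_nth 0). Qed.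

Hypothesis bU : basis_of U b.

Lemma basis_mxP c : (c \in U) = (c <= basis_mx)%MS.
Proof.
apply/idP/submxP => [Uc|[x ->]].
  exists (\row_i coord b i c); rewrite mulmx_basis_mx [LHS](coord_basis bU Uc).
  by apply: eq_bigr => i _; rewrite mxE.
rewrite mulmx_basis_mx; apply: memv_suml => i _; apply: memvZ.
by apply: (basis_mem bU); rewrite mem_nth ?size_tuple.
Qed.

Lemma basis_mx_free : row_free basis_mx.
Proof.
rewrite -kermx_eq0; apply/rowV0P => x /sub_kermxP; rewrite mulmx_basis_mx.
have /freeP bfree := basis_free bU => /bfree x0.
by apply/rowP => i; rewrite x0 mxE.
Qed.

Lemma pluckerE j : plucker b j = \det (colsub (enum_val j) basis_mx).
Proof. by congr (\det _); apply/matrixP => i i'; rewrite !mxE. Qed.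

End BasisMatrix.

Lemma dim_row_space (K : fieldType) d m (U : {vspace 'rV[K]_d}) (A : 'M_(m, d)) :
  (forall c, (c \in U) = (c <= A)%MS) -> \dim U = \rank A.
Proof.
move=> UA; have bU := vbasisP U.
have /eqmxP eqUA : (basis_mx (vbasis U) == A)%MS.
  apply/andP; split; apply/row_subP => i.
    by rewrite -UA (basis_mxP bU) row_sub.
  by rewrite -(basis_mxP bU) UA row_sub.
by rewrite -eqUA; apply/esym/eqP; exact: basis_mx_free bU.
Qed.

(** A change of basis multiplies all Pluecker coordinates by its determinant. *)
Lemma plucker_proportional (K : fieldType) d r (U : {vspace 'rV[K]_d})
    (b b' : r.-tuple 'rV[K]_d) : basis_of U b -> basis_of U b' ->
  exists c, plucker b' =1 (fun j => c * plucker b j).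
Proof.
move=> bU b'U; have /submxP[G GE] : (basis_mx b' <= basis_mx b)%MS.
  by apply/row_subP => i; rewrite -(basis_mxP bU) (basis_mxP b'U) row_sub.
by exists (\det G) => j; rewrite !pluckerE GE -mulmx_colsub det_mulmx.
Qed.

(** * Rank conditions in Pluecker coordinates *)

Section PluckerConditions.
Variables (k : fieldType) (d : nat).

Section Evaluation.
Variables (K : fieldExtType k) (r : nat) (b : r.-tuple 'rV[K]_d).

Definition pl_eval : {mpoly k[plucker_dim d r]} -> K :=
  meval (plucker b) \o map_mpoly (in_alg K).

HB.instance Definition _ := GRing.RMorphism.on pl_eval.

Lemma pl_evalC c : pl_eval c%:MP = in_alg K c.
Proof. by rewrite /pl_eval /= map_mpolyC mevalC. Qed.

Lemma pl_evalC_mx m n (A : 'M[k]_(m, n)) :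
  map_mx pl_eval (map_mx (@mpolyC _ k) A) = map_mx (in_alg K) A.
Proof. by apply/matrixP => i j; rewrite !mxE pl_evalC. Qed.

End Evaluation.

(** By homogeneity the vanishing of [p] on one basis implies its vanishing on
    all of them. *)
Lemma pl_eval_basis (K : fieldExtType k) r m (p : {mpoly k[plucker_dim d r]})
    (U : {vspace 'rV[K]_d}) (b b' : r.-tuple 'rV[K]_d) :
  p \is m.-homog -> basis_of U b -> basis_of U b' ->
  pl_eval b p = 0 -> pl_eval b' p = 0.
Proof.
move=> /dhomogP hp bU b'U p0; have [c bb'] := plucker_proportional bU b'U.
rewrite /pl_eval /= (meval_eq _ bb') (@meval_homog _ _ _ m).
  by rewrite [_.@[_]]p0 mulr0.
apply/dhomogP => u; rewrite mcoeff_msupp mcoeff_map_mpoly => h; apply: hp.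
by rewrite mcoeff_msupp; apply: contraNneq h => ->; rewrite raddf0.
Qed.

(** A bound on the rank amounts to the vanishing of minors, and these are
    homogeneous when the degrees of the entries depend on the row only. *)
Lemma constructible_rank (P : subspace_pred k d) (m e rho : nat -> nat)
    (I : nat -> finType)
    (M : forall r, I r -> 'M[{mpoly k[plucker_dim d r]}]_(m r, e r))
    (w : forall r, 'I_(m r) -> nat) :
  (forall r s i j, M r s i j \is (w r i).-homog) ->
  (forall (K : fieldExtType k) r (b : r.-tuple 'rV[K]_d) U, basis_of U b ->
    P K U <-> forall s, (\rank (map_mx (pl_eval b) (M r s)) <= rho r)%N) ->
  constructible_pred P.
Proof.
move=> hM PM.
have hminor r (s : I r) (f : {ffun 'I_(rho r).+1 -> 'I_(m r)})
    (g : {ffun 'I_(rho r).+1 -> 'I_(e r)}) :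
    \det (mxsub f g (M r s)) \is (\sum_i w r (f i))%N.-homog.
  by apply: dhomog_det => i j; rewrite mxE; exact: hM.
apply: constructible_ext (constructible_exists (fun r : 'I_d.+1 =>
  constructibleI (constructible_dim k d r)
    (constructible_forall (fun s : I r => constructible_forall (fun f =>
      constructible_forall (fun g => constructible_zero (hminor r s f g))))))) _ => K U.
have evalE r (b : r.-tuple 'rV[K]_d) s (f : {ffun 'I_(rho r).+1 -> 'I_(m r)})
    (g : {ffun 'I_(rho r).+1 -> 'I_(e r)}) :
    pl_eval b (\det (mxsub f g (M r s))) =
    \det (mxsub f g (map_mx (pl_eval b) (M r s))).
  by rewrite -det_map_mx map_mxsub.
split=> [[r [dU h]]|PU].
  have [b0 bU] : exists b : r.-tuple 'rV[K]_d, basis_of U b.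
    by rewrite -dU; exists (vbasis U); exact: vbasisP.
  apply/(PM _ _ _ _ bU) => s; apply/rank_minors => f g; rewrite -evalE.
  have [b [b'U]] := h s f g.
  exact: pl_eval_basis (hminor _ _ _ _) b'U bU.
have le_dU : (\dim U < d.+1)%N.
  by rewrite ltnS; have := dimvS (subvf U); rewrite dimvf /dim /= mul1n.
exists (Ordinal le_dU); split=> // s f g; exists (vbasis U); split.
  exact: vbasisP.
have /rank_minors/(_ f g) := (PM _ _ _ _ (vbasisP U)).1 PU s.
by rewrite -evalE.
Qed.

Section Chart.
Variable r : nat.
Implicit Type f : {ffun 'I_r -> 'I_d}.

(** The entries of [\adj (colsub f B) *m B], for [B] the matrix of a basis of a
    subspace [U], are Pluecker coordinates by Cramer's rule. Hence the rows of
    this matrix lie in [U], and span [U] when [colsub f B] is invertible. *)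
Definition chart f : 'M[{mpoly k[plucker_dim d r]}]_(r, d) :=
  \matrix_(i, a) 'X_(enum_rank [ffun j => if j == i then a else f j]).

Lemma chart_homog f i j : chart f i j \is 1.-homog.
Proof. by rewrite mxE dhomogX; apply/eqP; exact: mdeg1. Qed.

Lemma chart_eval (K : fieldExtType k) (b : r.-tuple 'rV[K]_d) f :
  map_mx (pl_eval b) (chart f) = \adj (colsub f (basis_mx b)) *m basis_mx b.
Proof.
apply/matrixP => i a.
rewrite !mxE /pl_eval /= map_mpolyX mevalXU pluckerE enum_rankK.
rewrite (expand_det_col _ i); apply: eq_bigr => s _.
rewrite !mxE ffunE eqxx mulrC; congr (_ * _).
rewrite /cofactor; congr (_ * \det _); apply/matrixP => s' j.
by rewrite !mxE ffunE eq_sym (negPf (neq_lift _ _)).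
Qed.

Variables (K : fieldExtType k) (b : r.-tuple 'rV[K]_d).
Variable U : {vspace 'rV[K]_d}.
Hypothesis bU : basis_of U b.

Lemma chart_sub f : (map_mx (pl_eval b) (chart f) <= basis_mx b)%MS.
Proof. by rewrite chart_eval submxMl. Qed.

Lemma chart_full :
  exists f, (basis_mx b <= map_mx (pl_eval b) (chart f))%MS.
Proof.
have [f unitf] := unit_colsub (basis_mx_free bU); exists f; rewrite chart_eval.
rewrite eqmxMfull // row_full_unit unitmxE.
have : \adj (colsub f (basis_mx b)) *m colsub f (basis_mx b) \in unitmx.
  by rewrite mul_adj_mx unitmxE det_scalar unitrX // -unitmxE.
by rewrite unitmx_mul => /andP[]; rewrite unitmxE.
Qed.

End Chart.

(** The map [u |-> u *m E] expresses in coordinates the inclusion of one quotient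
    in a larger one, see [pullback_image]. *)
Definition image_mem (K : fieldExtType k) (U : {vspace 'rV[K]_d}) e
    (E : 'M[k]_(d, e)) (x : 'rV[K]_e) : Prop :=
  exists2 u, u \in U & x = u *m map_mx (in_alg K) E.

Lemma image_memP (K : fieldExtType k) r (b : r.-tuple 'rV[K]_d) U e (E : 'M[k]_(d, e)) x :
  basis_of U b ->
  image_mem U E x <-> (x <= basis_mx b *m map_mx (in_alg K) E)%MS.
Proof.
move=> bU; split=> [[u]|/submxP[y ->]].
  by rewrite (basis_mxP bU) => ub ->; exact: submxMr.
exists (y *m basis_mx b); last by rewrite mulmxA.
by rewrite (basis_mxP bU) submxMl.
Qed.

(** As [E] has full rank, the matrix [W *m E] has rank [r] when the rows of a
    chart [W] span [U]. The inclusion of the row space of [W *m A] in that of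
    [W *m E] is then a bound by [r] on the rank of the two matrices stacked. On
    the other charts this bound still follows from the inclusion for [U], as the
    rows of [W] lie in [U]. *)
Lemma constructible_stable (P : subspace_pred k d) e (E : 'M[k]_(d, e))
    (J : nat -> finType) w
    (A : forall r, J r -> 'M[{mpoly k[plucker_dim d r]}]_(d, e)) :
  row_free E -> (forall r s i j, A r s i j \is w.-homog) ->
  (forall (K : fieldExtType k) r (b : r.-tuple 'rV[K]_d) U, basis_of U b ->
    P K U <-> forall s, (basis_mx b *m map_mx (pl_eval b) (A r s) <=
      basis_mx b *m map_mx (in_alg K) E)%MS) ->
  constructible_pred P.
Proof.
move=> freeE hA PA.
apply: (@constructible_rank P (fun r => (r + r)%N) (fun=> e) id
  (fun r => ({ffun 'I_r -> 'I_d} * J r)%type)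
  (fun r s => col_mx (chart s.1 *m map_mx (@mpolyC _ k) E) (chart s.1 *m A r s.2))
  (fun r i => match split i with inl _ => 1 + 0 | inr _ => 1 + w end)%N).
  move=> r s i j; rewrite mxE; case: (split i) => i'; apply: dhomog_mulmx => //.
  - exact: chart_homog.
  - by move=> i2 j2; rewrite mxE; exact: dhomogC.
  - exact: chart_homog.
move=> K r b U bU; rewrite (PA _ _ _ _ bU).
have rkE : \rank (basis_mx b *m map_mx (in_alg K) E) = r.
  rewrite mxrankMfree; first by apply/eqP; exact: basis_mx_free bU.
  by rewrite row_free_map.
split=> [h [f s]|h s] /=.
  rewrite map_col_mx !map_mxM pl_evalC_mx -[leqRHS]rkE; apply: mxrankS.
  rewrite col_mx_sub submxMr ?chart_sub //=.
  exact: submx_trans (submxMr _ (chart_sub _ _)) (h s).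
have [f fullf] := chart_full bU.
have := h (f, s); rewrite /= map_col_mx !map_mxM pl_evalC_mx.
set W := map_mx _ (chart f) in fullf *; set EK := map_mx _ E in rkE *.
set AK := map_mx _ (A r s) => rk_le.
apply: submx_trans (submxMr _ fullf) _.
apply: submx_trans (submxMr EK (chart_sub b f)).
have subW : (W *m EK <= col_mx (W *m EK) (W *m AK))%MS.
  by rewrite -addsmxE addsmxSl.
have leW : (r <= \rank (W *m EK))%N by rewrite -[leqLHS]rkE mxrankS // submxMr.
have : \rank (W *m EK) == \rank (col_mx (W *m EK) (W *m AK)).
  by rewrite eqn_leq mxrankS //= (leq_trans rk_le).
by rewrite (mxrank_leqif_sup subW) col_mx_sub => /andP[].
Qed.

End PluckerConditions.

(** * Linear, bilinear and dimension conditions *)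

Section BilinearConditions.
Variables (k : fieldType) (d e : nat).

Lemma constructible_linear (E A : 'M[k]_(d, e)) : row_free E ->
  constructible_pred (fun K U =>
    forall u, u \in U -> image_mem U E (u *m map_mx (in_alg K) A)).
Proof.
move=> freeE; apply: (@constructible_stable k d _ e E (fun=> unit : finType) 0
  (fun r _ => map_mx (@mpolyC _ k) A)) => //.
  by move=> r _ i j; rewrite mxE; exact: dhomogC.
move=> K r b U bU; rewrite pl_evalC_mx; split=> [h _|h u].
  apply/row_subP => i; rewrite row_mul -(image_memP _ _ bU); apply: h.
  by rewrite (basis_mxP bU) row_sub.
rewrite (basis_mxP bU) (image_memP _ _ bU) => ub.
exact: submx_trans (submxMr _ ub) (h tt).
Qed.

Definition bilinear_mx (K : fieldExtType k) (T : 'I_d -> 'M[k]_(d, e))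
    (u : 'rV[K]_d) : 'M[K]_(d, e) :=
  \sum_a u 0 a *: map_mx (in_alg K) (T a).

Lemma bilinear_mx_mulmx (K : fieldExtType k) T r (x : 'rV[K]_r) (W : 'M[K]_(r, d)) :
  bilinear_mx T (x *m W) = \sum_i x 0 i *: bilinear_mx T (row i W).
Proof.
under [RHS]eq_bigr do rewrite scaler_sumr.
rewrite exchange_big; apply: eq_bigr => a _ /=.
rewrite mxE scaler_suml; apply: eq_bigr => i _.
by rewrite scalerA mxE.
Qed.

(** Each [u'] in [U] gives a linear condition on [U]; on a chart it is enough to
    let [u'] run over the rows of the chart, which are polynomial in the
    Pluecker coordinates. *)
Lemma constructible_bilinear (E : 'M[k]_(d, e)) (T : 'I_d -> 'M[k]_(d, e)) :
  row_free E -> constructible_pred (fun K U => forall u u', u \in U ->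
    u' \in U -> image_mem U E (u *m bilinear_mx T u')).
Proof.
move=> freeE; apply: (@constructible_stable k d _ e E
  (fun r => ({ffun 'I_r -> 'I_d} * 'I_r)%type) 1
  (fun r s => \sum_a chart k s.1 s.2 a *: map_mx (@mpolyC _ k) (T a))) => //.
  move=> r s i j; rewrite summxE; apply: rpred_sum => a _; rewrite mxE.
  by apply: (dhomogM (chart_homog k _ _ _)); rewrite mxE; exact: dhomogC.
move=> K r b U bU.
have evalE f i : map_mx (pl_eval b) (\sum_a chart k f i a *: map_mx (@mpolyC _ k) (T a)) =
    bilinear_mx T (row i (map_mx (pl_eval b) (chart k f))).
  rewrite raddf_sum; apply: eq_bigr => a _.
  by rewrite [LHS]map_mxZ pl_evalC_mx !mxE.
split=> [h [f i]|h u u'].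
  rewrite /= evalE; apply/row_subP => j; rewrite row_mul -(image_memP _ _ bU).
  apply: h; rewrite (basis_mxP bU) ?row_sub //.
  exact: submx_trans (row_sub _ _) (chart_sub b f).
rewrite !(basis_mxP bU) (image_memP _ _ bU) => ub u'b.
apply: submx_trans (submxMr _ ub) _.
have [f fullf] := chart_full bU.
have /submxP[x ->] := submx_trans u'b fullf.
rewrite bilinear_mx_mulmx mulmx_sumr; apply: summx_sub => i _.
by rewrite -scalemxAr scalemx_sub // -evalE; exact: (h (f, i)).
Qed.

Definition kernel_vs (K : fieldExtType k) (Q : 'M[k]_(d, e)) : {vspace 'rV[K]_d} :=
  lker (linfun (mulmxr (map_mx (in_alg K) Q))).

Lemma kernel_vsP K Q u : (u \in kernel_vs K Q) = (u *m map_mx (in_alg K) Q == 0).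
Proof. by rewrite memv_ker lfunE. Qed.

Lemma kernel_vs_rank (K : fieldExtType k) Q r (b : r.-tuple 'rV[K]_d) U :
  basis_of U b ->
  (\rank (basis_mx b *m map_mx (in_alg K) Q) + \dim (U :&: kernel_vs K Q))%N = \dim U.
Proof.
move=> bU; rewrite (dim_row_space (basis_mxP bU)).
rewrite -(mxrank_mul_ker (basis_mx b) (map_mx (in_alg K) Q)); congr (_ + _)%N.
apply: dim_row_space => c; rewrite memv_cap sub_capmx -(basis_mxP bU).
congr (_ && _); rewrite kernel_vsP; exact/eqP/sub_kermxP.
Qed.

Lemma kernel_vs_dim K Q : \dim (kernel_vs K Q) = (d - \rank Q)%N.
Proof.
rewrite -(mxrank_map (in_alg K)) -mxrank_ker; apply: dim_row_space => c.
by rewrite kernel_vsP; exact/eqP/sub_kermxP.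
Qed.

Lemma constructible_rank_le (Q : 'M[k]_(d, e)) s :
  constructible_pred (fun K U => (\dim U <= s + \dim (U :&: kernel_vs K Q))%N).
Proof.
apply: (@constructible_rank k d _ id (fun=> e) (fun=> s)
  (fun r => {ffun 'I_r -> 'I_d}) (fun r f => chart k f *m map_mx (@mpolyC _ k) Q)
  (fun r i => 1 + 0)%N).
  move=> r f; apply: dhomog_mulmx => [i j|i j]; first exact: chart_homog.
  by rewrite mxE; exact: dhomogC.
move=> K r b U bU; rewrite -(kernel_vs_rank Q bU) leq_add2r.
split=> [h f|h].
  by rewrite map_mxM pl_evalC_mx (leq_trans _ h) // mxrankS // submxMr // chart_sub.
have [f fullf] := chart_full bU.
by apply: leq_trans (h f); rewrite map_mxM pl_evalC_mx mxrankS // submxMr.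
Qed.

(** Only finitely many values of the two dimensions occur, and each of them is
    singled out by finitely many rank conditions. *)
Lemma constructible_dims (Q : 'M[k]_(d, e)) (c : nat -> nat -> Prop) :
  constructible_pred (fun K U => c (\dim U) (\dim (U :&: kernel_vs K Q))).
Proof.
(* [s] stands for [\dim U - \dim (U :&: kernel_vs K Q)], characterised as the
   least number satisfying the condition of [constructible_rank_le]. *)
have cQ r s : constructible_pred (fun (K : fieldExtType k) (U : {vspace 'rV[K]_d}) =>
    [/\ \dim U = r, (\dim U <= s + \dim (U :&: kernel_vs K Q))%N,
      forall t : 'I_s, ~ (\dim U <= t + \dim (U :&: kernel_vs K Q))%N & c r (r - s)%N]).
  apply: constructible_ext (constructibleI (constructibleI (constructible_dim k d r)
    (constructible_rank_le Q s)) (constructibleI (constructible_forall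
      (fun t : 'I_s => constructibleC (constructible_rank_le Q t)))
    (constructible_const _ _ (c r (r - s)%N)))) _ => K U.
  by split=> [[[? ?] []]|[]].
apply: constructible_ext (constructible_exists (fun r : 'I_d.+1 =>
  constructible_exists (fun s : 'I_d.+1 => cQ r s))) _ => K U.
have le_cap : (\dim (U :&: kernel_vs K Q) <= \dim U)%N by exact: dimvS (capvSl _ _).
have le_dU : (\dim U <= d)%N.
  by have := dimvS (subvf U); rewrite dimvf /dim /= mul1n.
split=> [[r [s [dU le_s lt_s]]]|cU].
  suff -> : (r - s)%N = \dim (U :&: kernel_vs K Q) by rewrite dU.
  case: s le_s lt_s => -[|s] lts /= le_s lt_s; first by lia.
  by have /negP := lt_s ord_max; rewrite -ltnNge /=; lia.
have lt1 : (\dim U < d.+1)%N by [].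
have lt2 : (\dim U - \dim (U :&: kernel_vs K Q) < d.+1)%N by lia.
exists (Ordinal lt1), (Ordinal lt2); split=> //=; first by lia.
  by move=> t; apply/negP; rewrite -ltnNge; have := ltn_ord t; lia.
by rewrite subKn.
Qed.

End BilinearConditions.

(** * Subalgebras and ideals as points of a Grassmannian *)

Section PulledBackSubalgebras.
Variables (k : fieldType) (L : lieAlgType k).
Implicit Types A B C : set L.

(** The [v i] are independent modulo [B]. *)
Lemma coords_free A B d e (v : 'I_d -> L) (w : 'I_e -> L) (E : 'M[k]_(d, e)) :
  subspace A -> subspace B -> basis_mod A B v ->
  (forall i, B (v i - lincomb w (row i E))) -> row_free E.
Proof.
move=> sA sB vP hE; rewrite -kermx_eq0; apply/rowV0P => c /sub_kermxP cE0.
apply/(basis_mod_free sA sB vP).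
by have := lincomb_mulmx c sB hE; rewrite cE0 lincomb0 subr0.
Qed.

Lemma pullback_image (A' B : set L) d e (v : 'I_d -> L) (w : 'I_e -> L)
    (E : 'M[k]_(d, e)) (K : fieldExtType k) (U : {vspace 'rV[K]_d}) x :
  subspace A' -> subspace B -> basis_mod A' B w ->
  (forall i, B (v i - lincomb w (row i E))) ->
  pullback B v U (lincomb (pures K w) x) <-> image_mem U E x.
Proof.
move=> sA' sB wP hE.
have [sAK sBK] := (subspace_base_change K sA', subspace_base_change K sB).
have wPK := basis_mod_base_change K sA' sB wP.
have hEK (c : 'rV[K]_d) := base_change_coords c sB hE.
split=> [[c Uc hc]|[c Uc ->]]; exists c => //.
  have := subspaceD sBK hc (hEK c).
  rewrite addrA subrK -lincombB => /(basis_mod_free sAK sBK wPK)/eqP.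
  by rewrite subr_eq0 => /eqP.
by rewrite /= -opprB; apply: (subspaceN sBK); exact: hEK.
Qed.

Lemma lie_lincomb_coords B d e (v : 'I_d -> L) (z : L) (w : 'I_e -> L)
    (T : 'M[k]_(d, e)) (K : fieldExtType k) (u : 'rV[K]_d) :
  subspace B -> (forall j, B (lie (v j) z - lincomb w (row j T))) ->
  base_change K B (lie (lincomb (pures K v) u) (pure z 1) -
    lincomb (pures K w) (u *m map_mx (in_alg K) T)).
Proof.
move=> sB hT; have := base_change_coords u sB hT.
suff -> : lincomb (pures K (fun j => lie (v j) z)) u =
    lie (lincomb (pures K v) u) (pure z 1) by [].
rewrite lie_suml; apply: eq_bigr => j _.
by rewrite lieZl lie_pure mulr1.
Qed.

(** Brackets of elements of [A] are only known to lie in [A'], so the condition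
    that they lie in the subalgebra is expressed in coordinates of [A'] modulo
    [B], where [E] describes the inclusion of [A / B]. As [B] need not be an
    ideal, brackets of [A] with [B] give further conditions; these are linear,
    and finite in number because [B'] has finite codimension in [B] and its
    brackets with [A] lie in [B]. *)
Lemma constructible_subalgebra (A A' B B' : set L) d (v : 'I_d -> L) :
  subspace A -> subspace A' -> subspace B -> subspace B' ->
  A `<=` A' -> basis_mod A B v -> fincodim A' B -> fincodim B B' ->
  lie_prod A A `<=` A' -> lie_prod A B' `<=` B -> lie_prod B B `<=` B ->
  constructible_pred (fun K U => subalgebra (pullback B v (U : {vspace 'rV[K]_d}))).
Proof.
move=> sA sA' sB sB' AA' vP [e [w wP]] [m [y yP]] lieAA lieAB' lieBB.
have vA := basis_mod_in vP; have yB := basis_mod_in yP.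
have BA := basis_mod_sub vP.
have lieAA_in a b : A a -> A b -> A' (lie a b).
  by move=> Aa Ab; apply: lieAA; exact: lie_prod_in.
have [E hE] := basis_mod_coords wP (fun i => AA' _ (vA i)).
have /choice[T hT] a : exists T, forall j,
    B (lie (v j) (v a) - lincomb w (row j T)).
  by apply: (basis_mod_coords wP) => j; exact: lieAA_in.
have /choice[S hS] s : exists T, forall j,
    B (lie (v j) (y s) - lincomb w (row j T)).
  by apply: (basis_mod_coords wP) => j; apply: lieAA_in => //; exact/BA/yB.
have freeE := coords_free sA sB vP hE.
apply: constructible_ext (constructibleI (constructible_bilinear T freeE)
  (constructible_forall (fun s => constructible_linear (S s) freeE))) _ => K U.
set H := pullback B v U.
have [sAK sBK] := (subspace_base_change K sA, subspace_base_change K sB).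
have vPK := basis_mod_base_change K sA sB vP.
have sH : subspace H by exact: subspace_pull.
have BH : base_change K B `<=` H by exact: pull_ge.
have memH x : H (lincomb (pures K w) x) <-> image_mem U E x.
  exact: pullback_image sA' sB wP hE.
have vH u : H (lincomb (pures K v) u) <-> u \in U by exact: (pull_lincomb sAK sBK vPK).
have vvE (u u' : 'rV[K]_d) : base_change K B
    (lie (lincomb (pures K v) u) (lincomb (pures K v) u') -
     lincomb (pures K w) (u *m bilinear_mx T u')).
  rewrite [lincomb _ u']/lincomb lie_sumr mulmx_sumr.
  rewrite (big_morph _ (lincombD _) (lincomb0 _)) -sumrB.
  apply: (@subspace_sum _ _ (base_change K B)) => // a _.
  rewrite lieZr -scalemxAr lincombZ -scalerBr; apply: (subspaceZ _ sBK).
  exact: lie_lincomb_coords.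
have vyE (u : 'rV[K]_d) s : base_change K B
    (lie (lincomb (pures K v) u) (pures K y s) -
     lincomb (pures K w) (u *m map_mx (in_alg K) (S s))).
  exact: lie_lincomb_coords.
split=> [[bilH linH]|[_ lieH]]; last first.
  split=> [u u' Uu Uu'|s u Uu]; rewrite -memH.
    by rewrite -(subspace_congr sH (BH _ (vvE u u'))); apply: lieH; apply/vH.
  rewrite -(subspace_congr sH (BH _ (vyE u s))); apply: lieH; first exact/vH.
  by apply: BH; exact: base_change_pure.
have lie_vB u x : u \in U -> base_change K B x ->
    H (lie (lincomb (pures K v) u) x).
  move=> Uu Bx; have [c hc] := basis_mod_coord (basis_mod_base_change K sB sB' yP) Bx.
  rewrite -[x](subrK (lincomb (pures K y) c)) lieDr; apply: (subspaceD sH).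
    have uA := lincomb_in u sAK (basis_mod_in vPK).
    by apply: BH; exact: base_change_lie sB lieAB' uA hc.
  rewrite lie_sumr; apply: (@subspace_sum _ _ H) => // s _; rewrite lieZr.
  apply: (subspaceZ _ sH); rewrite (subspace_congr sH (BH _ (vyE u s))) memH.
  exact: linH.
split=> // t t' [u Uu]; rewrite -[\sum_i _]/(lincomb (pures K v) u) => Bt.
move=> [u' Uu']; rewrite -[\sum_i _]/(lincomb (pures K v) u') => Bt'.
rewrite -[t](subrK (lincomb (pures K v) u)) -[t'](subrK (lincomb (pures K v) u')).
move: (t - lincomb _ _) (t' - lincomb _ _) Bt Bt' => x x' Bx Bx'.
rewrite lieDl !lieDr; apply: (subspaceD sH); apply: (subspaceD sH).
- by apply: BH; exact: base_change_lie sB lieBB Bx Bx'.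
- by rewrite lieC; apply: (subspaceN sH); exact: lie_vB.
- exact: lie_vB.
- by rewrite (subspace_congr sH (BH _ (vvE u u'))) memH; exact: bilH.
Qed.

Lemma constructible_ideal (B : set L) d (v : 'I_d -> L) :
  subspace B -> basis_mod [set: L] B v -> lie_prod [set: L] B `<=` B ->
  constructible_pred (fun K U => lie_ideal (pullback B v (U : {vspace 'rV[K]_d}))).
Proof.
move=> sB vP lieTB; have sT := @subspaceT k L.
have /choice[T hT] a : exists T, forall j,
    B (lie (v j) (v a) - lincomb v (row j T)).
  exact: (basis_mod_coords vP).
have hE i : B (v i - lincomb v (row i (1%:M : 'M[k]_d))).
  by rewrite row1 lincomb_delta subrr; case: sB.
have freeE := coords_free sT sB vP hE.
apply: constructible_ext (constructible_forall (fun a =>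
  constructible_linear (T a) freeE)) _ => K U.
set H := pullback B v U.
have [sTK sBK] := (subspace_base_change K sT, subspace_base_change K sB).
have vPK := basis_mod_base_change K sT sB vP.
have sH : subspace H by exact: subspace_pull.
have BH : base_change K B `<=` H by exact: pull_ge.
have memH x : H (lincomb (pures K v) x) <-> image_mem U 1%:M x.
  exact: pullback_image sT sB vP hE.
have vH u : H (lincomb (pures K v) u) <-> u \in U by exact: (pull_lincomb sTK sBK vPK).
have vvE (u : 'rV[K]_d) a : base_change K B
    (lie (lincomb (pures K v) u) (pures K v a) -
     lincomb (pures K v) (u *m map_mx (in_alg K) (T a))).
  exact: lie_lincomb_coords.
have TK (t : tens L K) : base_change K [set: L] t by [].
split=> [linH|[_ lieH] a u Uu]; last first.
  rewrite -memH -(subspace_congr sH (BH _ (vvE u a))) lieC.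
  by apply: (subspaceN sH); apply: lieH; apply/vH.
split=> // t h [u Uu]; rewrite -[\sum_i _]/(lincomb (pures K v) u) => Bh.
rewrite -[h](subrK (lincomb (pures K v) u)) lieDr; apply: (subspaceD sH).
  by apply: BH; exact: base_change_lie sB lieTB (TK t) Bh.
have [c hc] := basis_mod_coord vPK (TK t).
rewrite -[t](subrK (lincomb (pures K v) c)) lieDl; apply: (subspaceD sH).
  rewrite lieC; apply: (subspaceN sH); apply: BH.
  exact: base_change_lie sB lieTB (TK _) hc.
rewrite lie_suml; apply: (@subspace_sum _ _ H) => // a _; rewrite lieZl.
apply: (subspaceZ _ sH); rewrite lieC; apply: (subspaceN sH).
by rewrite (subspace_congr sH (BH _ (vvE u a))) memH; exact: linH.
Qed.

(** A subspace defined over [k] between [B] and [A] has as coordinates the kernel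
    of a matrix with entries in [k], namely the coordinates modulo [C] of a basis
    of [A] modulo [B]. *)
Lemma pull_kernel (A B C : set L) d e (v : 'I_d -> L) (q : 'I_e -> L)
    (Q : 'M[k]_(d, e)) (K : fieldExtType k) :
  subspace A -> subspace B -> subspace C -> B `<=` C ->
  basis_mod A B v -> basis_mod A C q ->
  (forall i, C (v i - lincomb q (row i Q))) ->
  pullback B v (kernel_vs K Q) = base_change K C.
Proof.
move=> sA sB sC BC vP qP hQ.
have [sAK sCK] := (subspace_base_change K sA, subspace_base_change K sC).
have vPK := basis_mod_base_change K sA sB vP.
have qPK := basis_mod_base_change K sA sC qP.
have BCK := base_changeS (K := K) BC.
have key x c : base_change K B (x - lincomb (pures K v) c) ->
    base_change K C x <-> c \in kernel_vs K Q.
  move=> /BCK h; rewrite (subspace_congr sCK h).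
  rewrite (subspace_congr sCK (base_change_coords c sC hQ)).
  by rewrite (basis_mod_free sAK sCK qPK) kernel_vsP; split=> /eqP.
apply/seteqP; split=> x; first by move=> [c Qc hc]; apply/(key _ _ hc).
move=> Cx; have [c hc] := basis_mod_coord vPK (basis_mod_sub qPK Cx).
by exists c => //; apply/(key _ _ hc).
Qed.

(** Subspaces between [B (x) K] and [A (x) K] correspond to subspaces of
    [K^d], so it is enough to describe the latter. *)
Lemma constructible_inI (A B : set L)
    (Y : forall K : fieldExtType k, set (set (tens L K))) :
  subspace A -> subspace B ->
  (forall K H, Y K H ->
    [/\ subspace H, base_change K B `<=` H & H `<=` base_change K A]) ->
  (forall d (v : 'I_d -> L), basis_mod A B v ->
    constructible_pred (fun K U => Y K (pullback B v (U : {vspace 'rV[K]_d})))) ->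
  constructible_in A B Y.
Proof.
move=> sA sB YP cY d v vP; have [C CP] := cY d v vP; exists C => K.
apply/seteqP; split=> [H YH|_ [U + <-]]; last by rewrite CP.
have [sH BH HA] := YP _ _ YH.
have [U HE] := pull_surj (basis_mod_base_change K sA sB vP) sH BH HA.
have {HE}HE : H = pullback B v U by [].
by exists U => //; rewrite CP -HE.
Qed.

Lemma closed_inI (I : Type) (F : I -> set L) j (K : fieldExtType k)
    (H : set (tens L K)) :
  (forall i, subspace (F i)) -> subspace H -> base_change K (F j) `<=` H ->
  closed_in F H.
Proof.
move=> sF sH FH; apply/seteqP; split=> [x Hx i _|x hx].
  by apply: setsum_subl Hx; exact: subspace_base_change.
exact: (setsum_min sH (@subset_refl _ H) FH) (hx j Logic.I).
Qed.

End PulledBackSubalgebras.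

(** * The two kinds of filtrations *)

(** A subspace containing a term of the filtration is closed. *)
Lemma Xle_members (k : fieldType) (L : lieAlgType k) (I : Type) (F : I -> set L)
    i (K : fieldExtType k) (H : set (tens L K)) :
  (forall i, subspace (F i)) -> subspace H -> base_change K (F i) `<=` H ->
  Xle F K H <-> subalgebra H.
Proof.
move=> sF sH FH; split=> [[]|] //; split=> //.
exact: closed_inI sF sH FH.
Qed.

Section NFiltration.
Variables (k : fieldType) (L : lieAlgType k) (F : nat -> set L).
Hypothesis FN : N_filtration F.

Let sF i : subspace (F i). Proof. exact: N_subspace FN i. Qed.

Let F0K K : base_change K (F 0%N) = [set: tens L K].
Proof. by rewrite (N_full FN) base_changeT. Qed.

Lemma N_constructible (X : subalg_class L) :
  (forall l d (v : 'I_d -> L), basis_mod [set: L] (F l) v ->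
    constructible_pred (fun K U =>
      X K (pullback (F l) v (U : {vspace 'rV[K]_d})))) ->
  constructible_class F (fun=> [set: L])
    (fun K H n => codim [set: tens L K] H n) X.
Proof.
move=> cX l n; apply: constructible_inI => //.
  move=> K H [[[/members_subalgebra[sH _] _] FH] HT].
  by split.
move=> d v vP.
(* The codimension is a function of [\dim U] alone. *)
apply: constructible_ext (constructibleI (cX l d v vP)
  (constructible_dims (0 : 'M[k]_(d, 0)) (fun r _ => n = (d - r)%N))) _ => K U.
have sTK : subspace [set: tens L K] by exact: subspaceT.
have sFK := subspace_base_change K (sF l).
have vPK := basis_mod_base_change K (@subspaceT _ L) (sF l) vP.
rewrite base_changeT in vPK.
have codimE : codim [set: tens L K] (pullback (F l) v U) n <-> n = (d - \dim U)%N.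
  have := pull_codimE n sTK sFK vPK (subvf U).
  by rewrite (pullT sTK vPK) dimvf /dim /= mul1n.
rewrite -codimE; split=> [[XU cU]|[[[XU cU] _] _]]; split=> //.
by split=> //; exact: pull_ge.
Qed.

(** The members of [A_{j,n}] contain the [j]-th term of the filtration, as
    [well_covered_bound] requires. *)
Lemma N_stability (X : subalg_class L) : well_covered F ->
  forall n, exists l, forall j, (l <= j)%N -> forall K : fieldExtType k,
    codim_part_over F (fun K H n => codim [set: tens L K] H n) X l n (K := K) =
    codim_part_over F (fun K H n => codim [set: tens L K] H n) X j n (K := K).
Proof.
move=> wF n.
have lieF i j : lie_prod (F i) (F j) `<=` F (i + j)%N by exact: N_lie FN i j.
have [l bound] := well_covered_bound sF (N_decr FN) lieF wF n.
exists l => j le_lj K; apply/seteqP; split=> H [[XH cH] FH]; split=> //.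
  by apply: subset_trans FH; apply: base_changeS; apply: decr_subset le_lj; exact: N_decr FN.
have sH := members_subalgebra XH.
by apply: (bound K H j n) => //; rewrite F0K.
Qed.

Lemma N_theorem : well_covered F -> N_stable F (Xle F) /\ N_stable F (Xideal F).
Proof.
move=> wF.
have FlT l K d (v : 'I_d -> L) U :
    Xle F K (pullback (F l) v U) <-> subalgebra (pullback (F l) v U).
  apply: (Xle_members sF); last exact: pull_ge.
  by apply: subspace_pull; exact: subspace_base_change.
have lieF i j : lie_prod (F i) (F j) `<=` F (i + j)%N by exact: N_lie FN i j.
have lieTF l : lie_prod [set: L] (F l) `<=` F l by rewrite -(N_full FN) => x /lieF.
have cle l d (v : 'I_d -> L) : basis_mod [set: L] (F l) v ->
    constructible_pred (fun K U => Xle F K (pullback (F l) v (U : {vspace 'rV[K]_d}))).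
  move=> vP; apply: constructible_ext (@constructible_subalgebra _ _
    [set: L] [set: L] (F l) (F l) d v _ _ _ _ _ vP _ _ _ _ _) _ => //.
  - exact: N_fincodim FN l.
  - (* [F l] has codimension zero in itself. *)
    exists 0%N, (fun=> 0); apply: basis_modI => //; try by [].
    + by case=> m; rewrite ltn0.
    + by move=> x Fx; exists 0; rewrite lincomb0 subr0.
    + by move=> c _; apply/rowP; case.
  - apply: lspan_min => // _ [x _ [y Fy <-]].
    by apply: lieTF; exact: lie_prod_in.
  - by move=> K U; rewrite FlT.
split; split; [apply: N_constructible|exact: N_stability|apply: N_constructible|exact: N_stability].
- exact: cle.
- move=> l d v vP; apply: constructible_ext (constructibleI (cle l d v vP)
    (constructible_ideal (sF l) vP (lieTF l))) _ => K U.
  by split=> -[].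
Qed.

End NFiltration.

Section ZFiltration.
Variables (k : fieldType) (L : lieAlgType k) (F : int -> set L).
Hypothesis FZ : Z_filtration F.

Let sF i : subspace (F i). Proof. exact: Z_subspace FZ i. Qed.

Let lieF i j : lie_prod (F i) (F j) `<=` F (i + j). Proof. exact: Z_lie FZ i j. Qed.

Lemma Z_subset i j : (i <= j)%R -> F j `<=` F i.
Proof.
move=> le_ij; have -> : j = i + `|j - i|%N%:Z by lia.
have := @decr_subset _ (fun n => F (i + n%:Z)) 0 `|j - i|%N.
rewrite addr0; apply=> // n; have -> : i + n.+1%:Z = i + n%:Z + 1 by lia.
exact: Z_decr FZ _.
Qed.

(** Finiteness is given relative to [F 0] only: compare [F i] and [F j] through
    terms [F m] and [F M] with [m <= 0 <= M]. *)
Lemma Z_fincodim i j : (i <= j)%R -> fincodim (F i) (F j).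
Proof.
move=> le_ij; pose m := Order.min i 0; pose M := Order.max j 0.
have [m0 mi] : (m <= 0)%R /\ (m <= i)%R by rewrite /m; lia.
have [M0 Mj] : (0 <= M)%R /\ (j <= M)%R by rewrite /M; lia.
have [mfin _] := Z_commensurable FZ m; have [_ Mfin] := Z_commensurable FZ M.
rewrite (setIidr (Z_subset m0)) in mfin; rewrite (setIidl (Z_subset M0)) in Mfin.
have mM := fincodim_trans (sF m) (sF 0) (sF M) mfin Mfin.
have iM : (i <= M)%R by exact: le_trans le_ij Mj.
have [n iMfin] := fincodim_subl (sF m) (sF i) (sF M) (Z_subset iM) (Z_subset mi) mM.
have [n' h _] := codim_le (sF i) (sF M) (sF j) (Z_subset Mj) (Z_subset le_ij) iMfin.
by exists n'.
Qed.

(** Write [U0] for the kernel of [Q], which corresponds to [C]. The two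
    codimensions of [C :&: H] are those of [U :&: U0] in [U0] and in [U], and
    [U0] has dimension [d - \rank Q] for all [K]. *)
Lemma codim_sum_pullback (A B C : set L) d e (v : 'I_d -> L) (q : 'I_e -> L)
    (Q : 'M[k]_(d, e)) (K : fieldExtType k) (U : {vspace 'rV[K]_d}) n :
  subspace A -> subspace B -> subspace C -> B `<=` C ->
  basis_mod A B v -> basis_mod A C q ->
  (forall i, C (v i - lincomb q (row i Q))) ->
  codim_sum (pullback B v U) (base_change K C) n <->
  n = ((d - \rank Q - \dim (U :&: kernel_vs K Q)) +
       (\dim U - \dim (U :&: kernel_vs K Q)))%N.
Proof.
move=> sA sB sC BC vP qP hQ.
have [sAK sBK] := (subspace_base_change K sA, subspace_base_change K sB).
have vPK := basis_mod_base_change K sA sB vP.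
rewrite -(pull_kernel K sA sB sC BC vP qP hQ) -(kernel_vs_dim K Q) capvC.
rewrite /codim_sum (pullI sAK sBK vPK).
split=> [[a [b [ha hb ->]]]|->].
  move: ha hb; rewrite (pull_codimE _ sAK sBK vPK) ?capvSl // => ->.
  by rewrite (pull_codimE _ sAK sBK vPK) ?capvSr // => ->.
exists (\dim (kernel_vs K Q) - \dim (kernel_vs K Q :&: U))%N.
exists (\dim U - \dim (kernel_vs K Q :&: U))%N; split=> //.
  by rewrite (pull_codimE _ sAK sBK vPK) ?capvSl.
by rewrite (pull_codimE _ sAK sBK vPK) ?capvSr.
Qed.

(** Commensurability is implied by the two codimensions being finite. *)
Lemma X0le_members l K (H : set (tens L K)) n :
  subspace H -> base_change K (F l) `<=` H ->
  X0le F K H /\ codim_sum H (base_change K (F 0)) n <->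
  subalgebra H /\ codim_sum H (base_change K (F 0)) n.
Proof.
move=> sH FH; split=> [[[XH _] cH]|[aH cH]].
  by split=> //; apply/(Xle_members sF sH FH).
split=> //; split; first exact/(Xle_members sF sH FH).
by case: cH => a [b [ha hb _]]; split; rewrite setIC; [exists b|exists a].
Qed.

Lemma Z_theorem : Z_well_covered F -> Z_stable F (X0le F).
Proof.
move=> wF; split.
  move=> l n; have le_l : (- l%:Z <= l%:Z)%R by lia.
  apply: constructible_inI => // [K H [[[/members_subalgebra[sH _] _] FH] HF]|d v vP].
    by split.
  have [e [q qP]] := @Z_fincodim (- l%:Z) 0 ltac:(lia).
  have [Q hQ] := basis_mod_coords qP (basis_mod_in vP).
  apply: constructible_ext (constructibleI (@constructible_subalgebra _ _
    (F (- l%:Z)) (F (- l%:Z + - l%:Z)) (F l) (F (l%:Z + l%:Z)) d v _ _ _ _ _ vP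
    _ _ _ _ _) (constructible_dims Q (fun r c =>
      n = ((d - \rank Q - c) + (r - c))%N))) _ => //.
  - by apply: Z_subset; lia.
  - by apply: Z_fincodim; lia.
  - by apply: Z_fincodim; lia.
  - (* The terms [A = F (- l)], [A' = F (- 2 l)], [B = F l], [B' = F (2 l)]
       satisfy [lie_prod A B' `<=` B] because [- l + 2 l = l]. *)
    have : lie_prod (F (- l%:Z)) (F (l%:Z + l%:Z)) `<=` F (- l%:Z + (l%:Z + l%:Z)) by [].
    by rewrite addKr.
  - by apply: (subset_trans (lieF (i := l) (j := l))); apply: Z_subset; lia.
  move=> K U.
  have sH : subspace (pullback (F l) v U).
    by apply: subspace_pull; exact: subspace_base_change.
  have FH : base_change K (F l) `<=` pullback (F l) v U by exact: pull_ge.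
  have Fl0 : F l `<=` F 0 by apply: Z_subset; lia.
  rewrite -(codim_sum_pullback U n (sF (- l%:Z)) (sF l) (sF 0) Fl0 vP qP hQ).
  rewrite -(X0le_members n sH FH).
  split=> [XH|[[XH _] _] //]; split; first by split.
  have vPK := basis_mod_base_change K (sF _) (sF _) vP.
  exact: (pull_le (subspace_base_change K (sF _)) vPK).
move=> n; have [l bound] := well_covered_bound (fun i => sF i%:Z)
  (fun i => @Z_subset i%:Z i.+1%:Z ltac:(lia)) (fun i j => @lieF i%:Z j%:Z) wF n.
exists l => j le_lj K; apply/seteqP; split=> H [[XH cH] FH]; split=> //.
  by apply: subset_trans FH; apply: base_changeS; exact: Z_subset.
have [sH lieH] := members_subalgebra XH; have [a [b [ha _ nE]]] := cH.
have sF0K := subspace_base_change K (sF 0).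
(* The bound applies to subalgebras of the positive part. *)
suff : base_change K (F l) `<=` base_change K (F 0) `&` H by move=> h x /h[].
apply: (bound K _ j a) ha _ => //; last by rewrite nE leq_addr.
  split=> [|x y [F0x Hx] [F0y Hy]]; first exact: subspaceI.
  split; last exact: lieH.
  by apply: base_change_lie F0x F0y => //; exact: lieF 0 0.
move=> x Fx; split; last exact: FH.
by move: x Fx; apply: base_changeS; exact: Z_subset.
Qed.

End ZFiltration.

Theorem theorem2p28 (k : fieldType) :
  (forall (L : lieAlgType k) (F : nat -> set L),
     N_filtration F -> well_covered F ->
     N_stable F (Xle F) /\ N_stable F (Xideal F)) /\
  (forall (L : lieAlgType k) (F : int -> set L),
     Z_filtration F -> Z_well_covered F ->
     Z_stable F (X0le F)).
Proof.
split=> L F hF wF; first exact: N_theorem.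
exact: Z_theorem.
Qed.
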